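(* For all integers $t,\nu\geq1$ there exists an integer $\psi=\psi(t,\nu)\geq1$ with the following property. Let $G$ be a (theta, prism)-free graph with no clique of cardinality $t$, let $a,b\in V(G)$ be distinct and non-adjacent, and let $\mathcal{P}$ be a collection of pairwise internally disjoint induced paths in $G$ from $a$ to $b$ with $|\mathcal{P}|\geq\psi$. For each $P\in\mathcal{P}$ let $a_P$ be the neighbor of $a$ in $P$. Then there exist $P_1,\ldots,P_\nu\in\mathcal{P}$ such that $\{a_{P_1},\ldots,a_{P_\nu},b\}$ is a stable set in $G$, and for all $i,j\in\{1,\ldots,\nu\}$ with $i<j$, $a_{P_i}$ has a neighbor in $P_j^*\setminus\{a_{P_j}\}$.
   Context: Graphs finite simple. For a path $P$, $P^*$ denotes its interior (vertices other than its ends). Theta: two non-adjacent vertices joined by three internally disjoint induced paths of length $\ge2$ with pairwise anticomplete interiors. Prism: two disjoint triangles $\{a_1,a_2,a_3\},\{b_1,b_2,b_3\}$, disjoint induced paths $P_i$ from $a_i$ to $b_i$, with $a_ia_j,b_ib_j$ the only edges between $P_i,P_j$. (Theta, prism)-free: no induced subgraph isomorphic to a theta or a prism. *)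

(* Defs.v *)
From mathcomp Require Import all_boot.
Set Implicit Arguments.
Unset Strict Implicit.
Unset Printing Implicit Defensive.

Record sgraph := SGraph {
  vertex :> finType;
  edge : rel vertex;
  edge_sym : symmetric edge;
  edge_irrefl : irreflexive edge
}.

Definition isomorphic (G H : sgraph) : Prop :=
  exists2 f : G -> H, bijective f & forall x y, edge (f x) (f y) = edge x y.

Section Induced.
Variables (G : sgraph) (S : {set G}).

Definition induced_edge : rel {x : G | x \in S} :=
  fun x y => edge (val x) (val y).

Lemma induced_edge_sym : symmetric induced_edge.
Proof. by move=> x y; apply: edge_sym. Qed.

Lemma induced_edge_irrefl : irreflexive induced_edge.
Proof. by move=> x; apply: edge_irrefl. Qed.

Definition induced : sgraph := SGraph induced_edge_sym induced_edge_irrefl.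

End Induced.

Section Notions.
Variable G : sgraph.
Implicit Types (a b x y : G) (p : seq G) (A B : {set G}).

Definition clique A : Prop := {in A &, forall x y, x != y -> edge x y}.

Definition stable A : Prop := {in A &, forall x y, ~~ edge x y}.

Definition anticomplete A B : Prop :=
  forall x y, x \in A -> y \in B -> ~~ edge x y.

(* A path is the sequence of all its vertices, ends included, listed from a   *)
(* to b; the subgraph "induced path with ends a and b" determines this        *)
(* sequence, and conversely.                                                  *)
Definition induced_path a b p : Prop :=
  [/\ ohead p = Some a,
      last a p = b,
      uniq p
    & forall i j, i < j < size p -> edge (nth a p i) (nth a p j) = (j == i.+1)].

Definition path_length p : nat := (size p).-1.

Definition interior a b p : {set G} := [set x in p | (x != a) && (x != b)].

(* On an induced path from a to b != a, the second vertex is the unique       *)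
(* neighbor of a: see [edge_end_nbr].                                         *)
Definition end_nbr a p : G := nth a p 1.

Lemma edge_end_nbr a b p : a != b -> induced_path a b p ->
  {in p, forall x, edge a x = (x == end_nbr a p)} /\ end_nbr a p \in p.
Proof.
case: p => [|x [|y p]] /eqP neq_ab; rewrite /induced_path /=.
- by case.
- by case=> [[->]] /neq_ab.
case=> [[->]] _ /and3P[a_notin y_notin p_uniq] ind; split; last first.
  by rewrite /end_nbr /= !inE eqxx orbT.
have edge_ay : edge a y by rewrite (ind 0 1).
move=> z; rewrite inE => /predU1P[->|].
  rewrite edge_irrefl /end_nbr /=; apply/esym/negbTE/eqP => eq_ay.
  by rewrite -eq_ay edge_irrefl in edge_ay.
rewrite /end_nbr /= => z_in.
have lt_iz : 0 < (index z (y :: p)).+1 < (size p).+2.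
  by rewrite -index_mem in z_in.
have nth_z : nth a [:: a, y & p] (index z (y :: p)).+1 = z := nth_index a z_in.
have := ind _ _ lt_iz.
by rewrite nth_z => ->; rewrite eqSS /= (eq_sym z); case: (y == z).
Qed.

Definition is_theta : Prop :=
  exists (a b : G) (P : 'I_3 -> seq G),
    [/\ a != b,
        ~~ edge a b,
        forall i, induced_path a b (P i) /\ 2 <= path_length (P i),
        forall i j, i != j ->
          [disjoint interior a b (P i) & interior a b (P j)] /\
          anticomplete (interior a b (P i)) (interior a b (P j))
      & forall x, exists i, x \in P i].

Definition is_prism : Prop :=
  exists (a b : 'I_3 -> G) (P : 'I_3 -> seq G),
    [/\ forall i j, i != j -> edge (a i) (a j) /\ edge (b i) (b j),
        forall i j, a i != b j,
        forall i, induced_path (a i) (b i) (P i),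
        forall i j, i != j ->
          [disjoint P i & P j] /\
          (forall x y, x \in P i -> y \in P j ->
             edge x y = ((x == a i) && (y == a j)) || ((x == b i) && (y == b j)))
      & forall x, exists i, x \in P i].

End Notions.

Definition theta_prism_free (G : sgraph) : Prop :=
  forall H : sgraph, is_theta H \/ is_prism H ->
  ~ exists S : {set G}, isomorphic (induced S) H.

(* Main.v *)
(* Idea. Ramsey's theorem reduces the statement to one impossible case: many
   internally disjoint induced a-b paths whose first vertices are stable, not
   adjacent to b, and each with no neighbor on another path.  Let D be the union
   of these paths without a, and call the first vertices leaves: each has
   exactly one neighbor in D.

   As G is theta-free, no vertex of D is joined to three leaves through three
   pairwise anticomplete connected sets (a would be the other end of a theta).
   Let U be a connected subset of D containing b and a leaf, S a component of
   D \ N[U] with many leaves, and U maximal.  The paths leave S through distinct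
   vertices of N(U); by Ramsey many of these are pairwise non-adjacent; let z be
   one of them.  By maximality of U, the leaves of S are in at least two
   components of S \ N(z).  Theta-freeness makes the attachments of different
   such components in N(z) complete to each other, and prism-freeness shows that
   no other chosen vertex z' has a neighbor in these components; by maximality,
   z' is then complete to the attachments.  Every path through a z' crosses an
   attachment, so there are t attachments, two of which are non-adjacent, and
   with three of the chosen vertices they form K_{2,3}, a theta.

   A first pair (U, S) is obtained by growing a connected set from b until the
   leaves are separated from each other for the first time. *)
Require Import Defs.
From mathcomp Require Import all_boot zify.
Set Implicit Arguments.
Unset Strict Implicit.
Unset Printing Implicit Defensive.

(** * Connected sets and induced paths *)

Section InducedPaths.
Variable G : sgraph.
Implicit Types (x y z : G) (p q : seq G) (X Y Z : {set G}).

(** Thetas and prisms are always obtained from three connected sets with few prescribed edges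
    between them; induced paths are chosen inside these sets only at the very end, so no path has to
    be rerouted. Leaves dangle from the connected subsets of [D]: deleting them preserves
    connectivity, and a leaf in a connected set with a further vertex is not seen from the rest of
    [D]. A theta then costs only a vertex touching three separated connected sets that contain
    leaves, since [a] closes it. A prism is harder, as it needs two disjoint triangles and no stray
    edges. These come from shrinking: three sets with leaves attached to a connected set can be
    reduced until they meet in a single vertex, which is a theta, or in a triangle; paths of the
    prism may then run through [a] from leaf to leaf. The condition for [i < j] is not symmetric,
    hence Ramsey's theorem is stated for lists and ordered pairs: when only later starts see earlier
    paths, the list is reversed. *)

Lemma edgeC x y : edge x y = edge y x.
Proof. exact: edge_sym. Qed.

(** Recursive form of [induced_path] on the list [x :: q], suited to induction along the path. *)
Fixpoint ipath x q : bool :=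
  if q is y :: q' then
    [&& edge x y, x \notin q, all (fun z => ~~ edge x z) q' & ipath y q']
  else true.

Lemma ipath_edge d x q i j : ipath x q -> i < j < (size q).+1 ->
  edge (nth d (x :: q) i) (nth d (x :: q) j) = (j == i.+1).
Proof.
elim: q x i j => [|y q IH] x [|i] [|j] //=; rewrite ?ltnS ?ltn0 ?andbF //.
- case/and4P=> xy _ /allP xq _; case: j => [|j] /= lt_j; first by rewrite xy.
  by apply/negbTE/xq/mem_nth.
- by case/and4P=> _ _ _ ip lt_ij; rewrite IH.
Qed.

Lemma ipath_induced x q : ipath x q -> induced_path x (last x q) (x :: q).
Proof.
move=> ip; split=> //; last by move=> i j lt_ij; rewrite (ipath_edge x ip).
elim: q x ip => [|y q IH] x // /and4P[_ xq _ /IH uq].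
by rewrite cons_uniq xq uq.
Qed.

Lemma ipath_catr x p1 y p2 : ipath x (p1 ++ y :: p2) -> ipath y p2.
Proof. by elim: p1 x => [|w p1 IH] x /= /and4P[_ _ _] => [|/IH]. Qed.

Lemma ipath_path x p : ipath x p -> path (@edge G) x p.
Proof. by elim: p x => //= y p IH x /and4P[-> _ _ /IH]. Qed.

Lemma split_last_has (P : pred G) s : has P s ->
  exists s1 w s2, [/\ s = s1 ++ w :: s2, P w & ~~ has P s2].
Proof.
elim: s => [//|w s IH] /=; case: (boolP (has P s)) => [/IH[s1 [v [s2 [-> Pv hs]]]] _|hs].
  by exists (w :: s1), v, s2.
by rewrite orbF => Pw; exists [::], w, s.
Qed.

(** Once the rest of the walk has been made induced, jump from [x] to its last vertex that equals
    [x] or is adjacent to [x]. Nothing after that vertex is adjacent to [x], so the shortened path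
    is induced. *)
Lemma walk_ipath x q : path (@edge G) x q ->
  exists p, [/\ ipath x p, last x p = last x q & {subset x :: p <= x :: q}].
Proof.
elim: q x => [|y q IH] x /=; first by exists [::]; split.
case/andP=> xy /IH[p [ip lastp subp]].
have subx : {subset x :: y :: p <= [:: x, y & q]}.
  by move=> z; rewrite !(in_cons x); case: eqP => //= _; apply: subp.
have : has (fun w => (w == x) || edge x w) (y :: p) by rewrite /= xy orbT.
case/split_last_has=> p1 [w [p2 [def_p xw p2N]]].
have ipw : ipath w p2.
  case: p1 def_p => [[<- <-] //|v p1 [_ def_p]].
  by apply: (@ipath_catr y p1); rewrite -def_p.
have lastw : last w p2 = last y q.
  by rewrite -lastp -[LHS](last_cat x p1 (w :: p2)) -def_p.
have subw : {subset w :: p2 <= y :: p} by move=> z; rewrite def_p mem_cat orbC => ->.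
case/predU1P: xw => [wx|xw].
  subst w; exists p2; split=> // z z_in; apply: subx.
  by rewrite in_cons subw ?orbT.
exists (w :: p2); split=> //=.
  rewrite xw ipw andbT /= inE negb_or.
  have x_p2 : all (fun z => (z != x) && ~~ edge x z) p2.
    by move: p2N; rewrite -all_predC; apply: sub_all => z /=; rewrite negb_or.
  rewrite (_ : x != w) /=; last by apply: contraTneq xw => <-; rewrite edge_irrefl.
  apply/andP; split; last by apply: sub_all x_p2 => z /andP[].
  by apply/negP=> /(allP x_p2); rewrite eqxx.
move=> z; rewrite (in_cons x) => /predU1P[->|z_in]; first exact: mem_head.
by apply: subx; rewrite in_cons subw ?orbT.
Qed.

Definition relin X x y := [&& x \in X, y \in X & edge x y].
Definition conn X := [forall x in X, forall y in X, connect (relin X) x y].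
(** For [x] outside [X] this is the singleton of [x], so [x] always belongs to it. *)
Definition component X x := [set y | connect (relin X) x y].
Definition sep X Y := [forall x in X, forall y in Y, (x != y) && ~~ edge x y].
Definition nbr x X := [exists y in X, edge x y].

Lemma relin_sym X : symmetric (relin X).
Proof. by move=> x y; rewrite /relin edgeC andbCA. Qed.

Lemma connP X : reflect {in X &, forall x y, connect (relin X) x y} (conn X).
Proof.
apply: (iffP forall_inP) => [cX x y /cX/forall_inP|cX x xX]; first exact.
by apply/forall_inP=> y yX; apply: cX.
Qed.

Lemma sepP X Y : reflect {in X & Y, forall x y, (x != y) /\ ~~ edge x y} (sep X Y).
Proof.
apply: (iffP forall_inP) => [s x y /s/forall_inP sx /sx/andP[]//|s x xX].
by apply/forall_inP=> y yX; apply/andP/s.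
Qed.

Lemma nbrP x X : reflect (exists2 y, y \in X & edge x y) (nbr x X).
Proof. exact: exists_inP. Qed.

Lemma nbr_intro x y X : y \in X -> edge x y -> nbr x X.
Proof. by move=> yX xy; apply/nbrP; exists y. Qed.

Lemma sepC X Y : sep X Y = sep Y X.
Proof. by apply/sepP/sepP=> s x y xX yY; rewrite eq_sym edgeC; apply: s. Qed.

Lemma sepS X X' Y Y' : X' \subset X -> Y' \subset Y -> sep X Y -> sep X' Y'.
Proof.
move=> /subsetP sX /subsetP sY /sepP s.
by apply/sepP=> x y /sX xX /sY; apply: s.
Qed.

Lemma sepUl X X' Y : sep (X :|: X') Y = sep X Y && sep X' Y.
Proof.
apply/idP/andP=> [s|[/sepP s /sepP s']].
  by split; apply: sepS s; rewrite ?subsetUl ?subsetUr.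
by apply/sepP=> x y /setUP[] xX; [apply: s | apply: s'].
Qed.

Lemma sepUr X X' Y : sep Y (X :|: X') = sep Y X && sep Y X'.
Proof. by rewrite sepC sepUl !(sepC Y). Qed.

Lemma sep1 x Y : sep [set x] Y = (x \notin Y) && ~~ nbr x Y.
Proof.
apply/sepP/andP=> [s|[xY nY] _ y /set1P-> yY].
  by split; [apply/negP=> /(s x _ (set11 x))[/eqP] | apply/nbrP=> -[y /(s x _ (set11 x))[_ /negP]]].
by split; [apply: contraNneq xY => -> | apply: contra nY; apply: nbr_intro].
Qed.

Lemma sep_edge X Y x y : sep X Y -> x \in X -> y \in Y -> ~~ edge x y.
Proof. by move=> /sepP s xX /(s x y xX)[]. Qed.

Lemma sep_notin X Y x : sep X Y -> x \in X -> x \notin Y.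
Proof. by move=> /sepP s xX; apply/negP=> /(s x x xX)[/eqP]. Qed.

Lemma sep11 x y : sep [set x] [set y] = (x != y) && ~~ edge x y.
Proof.
apply/sepP/andP=> [s|s _ _ /set1P-> /set1P->//].
by apply: s; rewrite set11.
Qed.

Lemma nbrU x X Y : nbr x (X :|: Y) = nbr x X || nbr x Y.
Proof.
apply/nbrP/orP=> [[y /setUP[] yX xy]|[] /nbrP[y yX xy]].
- by left; apply: nbr_intro xy.
- by right; apply: nbr_intro xy.
- by exists y; rewrite // inE yX.
- by exists y; rewrite // inE yX orbT.
Qed.

Lemma nbr1 x y : nbr x [set y] = edge x y.
Proof. by apply/nbrP/idP=> [[_ /set1P->]|xy] //; exists y; rewrite ?set11. Qed.

Lemma walk_exit X x q : path (@edge G) x q -> x \in X -> last x q \notin X ->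
  exists q1 v q2, [/\ q = q1 ++ v :: q2, {subset x :: q1 <= X}, v \notin X
                    & edge (last x q1) v].
Proof.
elim: q x => [x _ -> //|y q IH] x /= /andP[xy pq] xX lastX.
have [yX|yX] := boolP (y \in X); last first.
  by exists [::], y, q; split=> // z /[!inE] /eqP->.
have [q1 [v [q2 [-> sub vX ev]]]] := IH y pq yX lastX.
exists (y :: q1), v, q2; split=> // z; rewrite inE => /predU1P[->//|]; exact: sub.
Qed.

Lemma connect_relin_walk X x y : connect (relin X) x y ->
  exists2 q, path (@edge G) x q & last x q = y /\ {subset q <= X}.
Proof.
case/connectP=> q pq ->; exists q; first by apply: sub_path pq => u v /and3P[].
split=> //; elim: q x pq => //= v q IH x /andP[/and3P[_ vX _] /IH sub] w.
by rewrite inE => /predU1P[->|/sub].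
Qed.

Lemma walk_connect X x q : path (@edge G) x q -> {subset x :: q <= X} ->
  connect (relin X) x (last x q).
Proof.
move=> pq sub; apply/connectP; exists q => //.
elim: q x pq sub => //= v q IH x /andP[xv pq] sub.
rewrite {1}/relin xv !sub ?inE ?eqxx ?orbT //=; apply: IH => // w w_in.
by apply: sub; rewrite inE w_in orbT.
Qed.

Lemma conn_exit F X x y : conn F -> x \in F -> x \in X -> y \in F -> y \notin X ->
  exists u v, [/\ u \in F, u \in X, v \in F, v \notin X & edge u v].
Proof.
move=> /connP cF xF xX yF yX.
have [q pq [lastq sub]] := connect_relin_walk (cF _ _ xF yF).
have [|q1 [v [q2 [def_q sub1 vX ev]]]] := walk_exit pq xX; first by rewrite lastq.
exists (last x q1), v; split=> //; last 2 first.
- by apply: sub1; rewrite mem_last.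
- by apply: sub; rewrite def_q mem_cat mem_head orbT.
have := mem_last x q1; rewrite inE => /predU1P[->//|l1].
by apply: sub; rewrite def_q mem_cat l1.
Qed.

Lemma conn_root X x : (forall y, y \in X -> connect (relin X) x y) -> conn X.
Proof.
move=> cX; apply/connP=> y z yX zX; apply: connect_trans (cX _ zX).
by rewrite (sym_connect_sym (@relin_sym X)) cX.
Qed.

Lemma relinS X Y x y : X \subset Y -> connect (relin X) x y -> connect (relin Y) x y.
Proof.
move=> /subsetP sub; apply: connect_sub => u v /and3P[/sub uY /sub vY uv].
by apply: connect1; rewrite /relin uY vY.
Qed.

Lemma conn1 x : conn [set x].
Proof. by apply: (@conn_root _ x) => y /set1P->. Qed.

Lemma connU X Y x y : conn X -> conn Y -> x \in X -> y \in Y ->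
  (x == y) || edge x y -> conn (X :|: Y).
Proof.
move=> /connP cX /connP cY xX yY xy; apply: (@conn_root _ x) => z /setUP[zX|zY].
  by apply: relinS (cX _ _ xX zX); apply: subsetUl.
have cyz : connect (relin (X :|: Y)) y z by apply: relinS (cY _ _ yY zY); apply: subsetUr.
case/predU1P: xy => [->//|xy]; apply: connect_trans cyz; apply: connect1.
by rewrite /relin !inE xX yY orbT.
Qed.

Lemma conn_add X x : conn X -> nbr x X -> conn (x |: X).
Proof. by move=> cX /nbrP[y yX xy]; apply: (connU (conn1 x) cX (set11 x) yX); rewrite xy orbT. Qed.

Lemma component_refl X x : x \in component X x.
Proof. by rewrite inE connect0. Qed.

Lemma component_sub X x : x \in X -> component X x \subset X.
Proof.
move=> xX; apply/subsetP=> y; rewrite inE => /connect_relin_walk[q _ [<- sub]].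
by have := mem_last x q; rewrite inE => /predU1P[->|/sub].
Qed.

Lemma component_closed X x u v : x \in X -> u \in component X x -> v \in X -> edge u v ->
  v \in component X x.
Proof.
move=> xX uC vX uv; have uX := subsetP (component_sub xX) _ uC.
by move: uC; rewrite !inE => /connect_trans; apply; apply: connect1; rewrite /relin uX vX.
Qed.

Lemma conn_component X x : x \in X -> conn (component X x).
Proof.
move=> xX; apply: (@conn_root _ x) => y /[!inE] /connectP[q pq ->].
elim/last_ind: q pq => [|q y' IH]; first by rewrite connect0.
rewrite rcons_path last_rcons => /andP[pq e1].
apply: connect_trans (IH pq) (connect1 _) => /=.
have l1 : last x q \in component X x by rewrite inE; apply/connectP; exists q.
  rewrite /relin.
case/and3P: e1 => _ yX e1; rewrite l1 e1 andbT /=.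
exact: component_closed e1.
Qed.

Lemma sub_component X Y x : conn Y -> Y \subset X -> x \in Y -> Y \subset component X x.
Proof.
by move=> /connP cY sub xY; apply/subsetP=> y yY; rewrite inE; apply: relinS sub _; apply: cY.
Qed.

Lemma conn_nbr X x y : conn X -> x \in X -> y \in X -> x != y ->
  nbr x (X :\ x).
Proof.
move=> cX xX yX xy.
have [||u [v [_ /set1P-> vX vx uv]]] := conn_exit (X := [set x]) cX xX _ yX.
- exact: set11.
- by rewrite inE eq_sym.
by apply: nbr_intro uv; rewrite inE vx.
Qed.

(** A maximum connected proper subset containing [v] misses only one vertex: adding a neighbor from
    outside keeps it connected, hence gives all of [X]. That neighbor is not a cut vertex. *)
Lemma conn_noncut X v : conn X -> v \in X -> 1 < #|X| ->
  exists x, [/\ x \in X, x != v & conn (X :\ x)].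
Proof.
move=> cX vX X2; pose P (Y : {set G}) := [&& conn Y, v \in Y & Y \proper X].
have P1 : P [set v].
  rewrite /P conn1 set11 /= properEcard sub1set vX cards1; exact: X2.
case: (arg_maxnP (fun Y : {set G} => #|Y|) P1) => Y /and3P[cY vY ltY] maxY.
have [_ [x xX xY]] := properP ltY.
have [u [w [uX uY wX wY uw]]] := conn_exit cX vX vY xX xY.
have cw : conn (w |: Y) by apply: conn_add => //; apply: nbr_intro uY _; rewrite edgeC.
have wv : w != v by apply: contraNneq wY => ->.
have sub : w |: Y \subset X by rewrite subUset sub1set wX proper_sub.
have defX : w |: Y = X.
  apply/eqP; rewrite eqEcard sub leqNgt; apply/negP=> lt1.
  have /maxY : P (w |: Y) by rewrite /P cw properEcard sub lt1 !inE vY orbT.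
  by rewrite cardsU1 wY add1n /= ltnn.
by exists w; split=> //; rewrite -defX setU1K.
Qed.

Lemma conn_two_noncut X : conn X -> 1 < #|X| ->
  exists x y, [/\ x != y, x \in X, y \in X, conn (X :\ x) & conn (X :\ y)].
Proof.
move=> cX X2; have /card_gt0P[v vX] : 0 < #|X| by apply: ltnW.
have [x [xX _ cx]] := conn_noncut cX vX X2.
have [y [yX yx cy]] := conn_noncut cX xX X2.
by exists x, y; split; rewrite // eq_sym.
Qed.

Lemma conn_ipath X x y : conn X -> x \in X -> y \in X ->
  exists p, [/\ ipath x p, last x p = y & {subset x :: p <= X}].
Proof.
move=> /connP cX xX yX; have [q /walk_ipath[p [ip lastp sub]] [lastq subq]] :=
  connect_relin_walk (cX x y xX yX).
exists p; split=> //; first by rewrite lastp.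
by move=> z /sub; rewrite inE => /predU1P[->//|/subq].
Qed.

End InducedPaths.

(** * Thetas and prisms from connected sets *)

Section Lift.
Variables (G : sgraph) (S : {set G}).

Lemma induced_path_val (a b : induced S) (p : seq (induced S)) :
  induced_path (val a) (val b) (map val p) -> induced_path a b p.
Proof.
case=> [hd lst uq ind]; split.
- by case: p hd {lst uq ind} => //= x p [/val_inj->].
- by apply: val_inj; rewrite -last_map.
- by rewrite -(map_inj_uniq val_inj).
- move=> i j /andP[lt_ij lt_j]; have lt_i := ltn_trans lt_ij lt_j.
  by rewrite -(ind i j) ?size_map ?lt_ij // !(nth_map a).
Qed.

Definition lift_seq (p : seq G) : seq (induced S) := pmap insub p.

Lemma lift_seqK p : {subset p <= S} -> map val (lift_seq p) = p.
Proof.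
move=> sub; rewrite /lift_seq (pmap_filter (@insubK _ _ _)); apply/all_filterP/allP=> x /sub xS.
by rewrite /= insubT.
Qed.

Lemma mem_lift_seq p x : {subset p <= S} -> (x \in lift_seq p) = (val x \in p).
Proof. by move=> sub; rewrite -(mem_map val_inj) lift_seqK. Qed.

End Lift.

Lemma isomorphic_refl (G : sgraph) : isomorphic G G.
Proof. by exists id => //; exists id. Qed.

Section Criteria.
Variable G : sgraph.
Hypothesis tpf : theta_prism_free G.
Implicit Types (x y z : G) (p q : seq G) (X Y Z : {set G}).

(** The subgraph induced by the union of the three paths is itself the theta, so the isomorphism is
    the identity and only membership proofs are carried along. *)
Lemma no_theta_paths (a b : G) (P : 'I_3 -> seq G) :
  a != b -> ~~ edge a b ->
  (forall i, induced_path a b (P i) /\ 2 <= path_length (P i)) ->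
  (forall i j, i != j -> sep (interior a b (P i)) (interior a b (P j))) -> False.
Proof.
move=> neq_ab nedge_ab pathP sepI.
pose S := [set x | [exists i, x \in P i]].
have subS i : {subset P i <= S} by move=> x xP; rewrite inE; apply/existsP; exists i.
have [ha la _ _] := (pathP ord0).1.
have aP : a \in P ord0 by case: (P ord0) ha => //= x p [->]; rewrite mem_head.
have bP : b \in P ord0.
  by rewrite -la; case: (P ord0) aP => //= x p _; apply: mem_last.
have aS := subS _ _ aP; have bS := subS _ _ bP.
pose a' : induced S := Sub a aS; pose b' : induced S := Sub b bS.
apply: (tpf (H := induced S)); last by exists S; apply: isomorphic_refl.
left; exists a', b', (fun i => lift_seq S (P i)); split=> //.
- move=> i; have [indP lenP] := pathP i; split.
    by apply: induced_path_val; rewrite lift_seqK //; apply: subS.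
  by rewrite /path_length -(size_map val) lift_seqK //; apply: subS.
- have in_int (i : 'I_3) (x : induced S) : x \in interior a' b' (lift_seq S (P i)) ->
      val x \in interior a b (P i).
    by rewrite !inE mem_lift_seq //; apply: subS.
  move=> i j /sepI s; split; last by move=> x y /in_int xi /in_int yj; apply: sep_edge xi yj.
  rewrite disjoint_subset; apply/subsetP=> x /in_int xi; rewrite inE.
  by apply: contra (sep_notin s xi) => /in_int.
- by move=> x; have := valP x; rewrite inE => /existsP[i xi]; exists i; rewrite mem_lift_seq //; apply: subS.
Qed.

Lemma no_prism_paths (a b : 'I_3 -> G) (P : 'I_3 -> seq G) :
  (forall i j, i != j -> edge (a i) (a j) /\ edge (b i) (b j)) ->
  (forall i j, a i != b j) ->
  (forall i, induced_path (a i) (b i) (P i)) ->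
  (forall i j, i != j -> forall x y, x \in P i -> y \in P j -> x != y /\
     edge x y = ((x == a i) && (y == a j)) || ((x == b i) && (y == b j))) -> False.
Proof.
move=> tri neq_ab pathP sepI.
pose S := [set x | [exists i, x \in P i]].
have subS i : {subset P i <= S} by move=> x xP; rewrite inE; apply/existsP; exists i.
have aP i : a i \in P i.
  by have [ha _ _ _] := pathP i; case: (P i) ha => //= x p [->]; rewrite mem_head.
have bP i : b i \in P i.
  have [_ la _ _] := pathP i; have := aP i; rewrite -la.
  by case: (P i) => //= x p _; apply: mem_last.
pose a' i : induced S := Sub (a i) (subS i _ (aP i)).
pose b' i : induced S := Sub (b i) (subS i _ (bP i)).
apply: (tpf (H := induced S)); last by exists S; apply: isomorphic_refl.
right; exists a', b', (fun i => lift_seq S (P i)); split=> //.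
- by move=> i; apply: induced_path_val; rewrite lift_seqK; [apply: pathP | apply: subS].
- move=> i j /sepI s; split.
    rewrite disjoint_subset; apply/subsetP=> x; rewrite inE !mem_lift_seq; try exact: subS.
    by move=> xi; apply/negP=> xj; have [/eqP] := s _ _ xi xj.
  move=> x y; rewrite !mem_lift_seq; try exact: subS.
  by move=> xi yj; have [_] := s _ _ xi yj.
- by move=> x; have := valP x; rewrite inE => /existsP[i xi]; exists i; rewrite mem_lift_seq //; apply: subS.
Qed.

(** An induced path from [x] to [y] is taken in each [H i] with the two ends added. Its interior
    lies in [H i], and its length is at least 2 because [x] and [y] are distinct and not
    adjacent. *)
Lemma no_theta (x y : G) (H : 'I_3 -> {set G}) :
  x != y -> ~~ edge x y ->
  (forall i, [/\ conn (H i), x \notin H i, y \notin H i, nbr x (H i) & nbr y (H i)]) ->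
  (forall i j, i != j -> sep (H i) (H j)) -> False.
Proof.
move=> neq_xy nxy HP sepH.
have pathE i : exists p, [/\ induced_path x y p, 2 <= path_length p & interior x y p \subset H i].
  have [cH xH yH xn yn] := HP i.
  have cxy : conn (x |: (y |: H i)).
    by apply: conn_add; [apply: conn_add | rewrite nbrU xn orbT].
  have [||p [ip lastp sub]] := conn_ipath (x := x) (y := y) cxy; rewrite ?inE ?eqxx ?orbT //.
  exists (x :: p); split.
  - by rewrite -lastp; apply: ipath_induced.
  - rewrite /path_length /=; case: p ip lastp {sub} => [_ /eqP|z [|z' p]] //=; first by rewrite (negPf neq_xy).
    by case/andP=> xz _ zy; move: nxy; rewrite -zy xz.
  - apply/subsetP=> z; rewrite inE => /and3P[/sub zs zx zy].
    by move: zs; rewrite !inE (negPf zx) (negPf zy).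
have /fin_all_exists[P PP] := pathE.
apply: (no_theta_paths (P := P) neq_xy nxy) => [i|i j ij]; first by have [] := PP i.
have [_ _ si] := PP i; have [_ _ sj] := PP j.
exact: sepS si sj (sepH i j ij).
Qed.

Lemma no_prism (d e : 'I_3 -> G) (H : 'I_3 -> {set G}) :
  (forall i j, d i != e j) ->
  (forall i, [/\ conn (H i), d i \in H i & e i \in H i]) ->
  (forall i j, i != j -> edge (d i) (d j) /\ edge (e i) (e j)) ->
  (forall i j, i != j -> forall x y, x \in H i -> y \in H j -> x != y /\
    (edge x y -> x = d i /\ y = d j \/ x = e i /\ y = e j)) -> False.
Proof.
move=> neq_de HP tri sepH.
have pathE i : exists p, induced_path (d i) (e i) p /\ {subset p <= H i}.
  have [cH dH eH] := HP i; have [p [ip lastp sub]] := conn_ipath cH dH eH.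
  by exists (d i :: p); rewrite -lastp; split=> //; apply: ipath_induced.
have /fin_all_exists[P PP] := pathE.
apply: (no_prism_paths (P := P) tri neq_de) => [i|i j ij x y xi yj]; first by have [] := PP i.
have [neq_xy exy] := sepH i j ij x y ((PP i).2 _ xi) ((PP j).2 _ yj).
split=> //; apply/idP/orP=> [/exy[[-> ->]|[-> ->]]|[]/andP[/eqP-> /eqP->]].
- by left; rewrite !eqxx.
- by right; rewrite !eqxx.
- by have [] := tri i j ij.
- by have [] := tri i j ij.
Qed.

End Criteria.

Definition o0 : 'I_3 := @Ordinal 3 0 isT.
Definition o1 : 'I_3 := @Ordinal 3 1 isT.
Definition o2 : 'I_3 := @Ordinal 3 2 isT.

Lemma ord3_ind (P : 'I_3 -> Prop) : P o0 -> P o1 -> P o2 -> forall i, P i.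
Proof.
move=> P0 P1 P2 [[|[|[|//]]] lt_i3].
- by rewrite (_ : Ordinal _ = o0) //; apply: val_inj.
- by rewrite (_ : Ordinal _ = o1) //; apply: val_inj.
- by rewrite (_ : Ordinal _ = o2) //; apply: val_inj.
Qed.

Lemma ord3_pairs (R : 'I_3 -> 'I_3 -> Prop) :
  (forall i j, R i j -> R j i) -> R o0 o1 -> R o0 o2 -> R o1 o2 ->
  forall i j, i != j -> R i j.
Proof.
move=> Rsym R01 R02 R12.
by apply: ord3_ind; apply: ord3_ind => // _; apply: Rsym.
Qed.

Lemma ord3_third (i j : 'I_3) : i != j ->
  exists k, [/\ k != i, k != j & forall l, [\/ l = i, l = j | l = k]].
Proof.
move: i j; apply: ord3_pairs => [i j [k [ki kj all]]||| ].
- by exists k; split=> // l; case: (all l) => ->; [constructor 2 | constructor 1 | constructor 3].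
- by exists o2; split=> //; apply: ord3_ind; [constructor 1 | constructor 2 | constructor 3].
- by exists o1; split=> //; apply: ord3_ind; [constructor 1 | constructor 3 | constructor 2].
- by exists o0; split=> //; apply: ord3_ind; [constructor 3 | constructor 1 | constructor 2].
Qed.

Definition tri3 (T : Type) (x y z : T) (i : 'I_3) : T :=
  if i == o0 then x else if i == o1 then y else z.

Section Only.
Variable G : sgraph.
Implicit Types (x y z : G) (X Y Z : {set G}) (R : G -> G -> Prop).

(** [R] collects the edges allowed between two disjoint sets; for the empty [R] this is [sep]. *)
Definition only R X Y := {in X & Y, forall x y, x != y /\ (edge x y -> R x y)}.

Lemma only_sep R X Y : sep X Y -> only R X Y.
Proof.
move=> s x y xX yY; split; first by apply: contraTneq xX => ->; rewrite sepC in s; apply: sep_notin yY.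
by move=> xy; case/negP: (sep_edge s xX yY).
Qed.

Lemma onlyUl R X X' Y : only R X Y -> only R X' Y -> only R (X :|: X') Y.
Proof. by move=> o o' x y /setUP[] xX; [apply: o | apply: o']. Qed.

Lemma onlyUr R X Y Y' : only R X Y -> only R X Y' -> only R X (Y :|: Y').
Proof. by move=> o o' x y xX /setUP[] yY; [apply: o | apply: o']. Qed.

Lemma only1 R x y : x != y -> (edge x y -> R x y) -> only R [set x] [set y].
Proof. by move=> xy e _ _ /set1P-> /set1P->. Qed.

Lemma onlyS (R R' : G -> G -> Prop) X X' Y Y' : X' \subset X -> Y' \subset Y ->
  only R X Y -> (forall x y, R x y -> R' x y) -> only R' X' Y'.
Proof.
move=> /subsetP sX /subsetP sY o sR x y /sX xX /sY yY.
by have [h1 h2] := o x y xX yY; split=> // /h2/sR.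
Qed.

Definition two d0 d1 e0 e1 x y := x = d0 /\ y = d1 \/ x = e0 /\ y = e1 :> G.

Lemma sep_disjoint X Y : sep X Y -> [disjoint X & Y].
Proof. by move=> s; rewrite disjoint_subset; apply/subsetP=> x /(sep_notin s). Qed.

Lemma disjointU1r x X Y : x \notin X -> [disjoint X & Y] -> [disjoint X & x |: Y].
Proof.
move=> xX XY; rewrite disjoint_subset; apply/subsetP=> y yX; rewrite !inE negb_or.
by rewrite (disjointFr XY yX) andbT; apply: contraNneq xX => <-.
Qed.

Lemma disjoint1r x X : x \notin X -> [disjoint X & [set x]].
Proof. by rewrite disjoint_sym disjoints1. Qed.

Hypothesis tpf : theta_prism_free G.

Lemma no_prism3 (d0 d1 d2 e0 e1 e2 : G) (H0 H1 H2 : {set G}) :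
  [/\ d0 != e0, d1 != e1 & d2 != e2] ->
  [/\ edge d0 d1, edge d0 d2 & edge d1 d2] ->
  [/\ edge e0 e1, edge e0 e2 & edge e1 e2] ->
  [/\ conn H0, conn H1 & conn H2] ->
  [/\ d0 \in H0, d1 \in H1 & d2 \in H2] ->
  [/\ e0 \in H0, e1 \in H1 & e2 \in H2] ->
  only (two d0 d1 e0 e1) H0 H1 ->
  only (two d0 d2 e0 e2) H0 H2 ->
  only (two d1 d2 e1 e2) H1 H2 -> False.
Proof.
move=> [n0 n1 n2] [d01 d02 d12] [e01 e02 e12] [c0 c1 c2] [dH0 dH1 dH2] [eH0 eH1 eH2] o01 o02 o12.
pose d := tri3 d0 d1 d2; pose e := tri3 e0 e1 e2; pose H := tri3 H0 H1 H2.
have sepH : forall i j, i != j -> only (two (d i) (d j) (e i) (e j)) (H i) (H j).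
  apply: ord3_pairs => // i j o x y xi yj; have [xy exy] := o y x yj xi.
  rewrite eq_sym edgeC; split=> // /exy[[-> ->]|[-> ->]]; [by left | by right].
have HP : forall i, [/\ conn (H i), d i \in H i & e i \in H i] by apply: ord3_ind.
apply: (@no_prism _ tpf d e H) => //.
- move=> i j; have [->|ij] := eqVneq i j; first by apply: (ord3_ind (P := fun j => d j != e j)).
  by have [_ di _] := HP i; have [_ _ ej] := HP j; have [] := sepH i j ij _ _ di ej.
- by apply: ord3_pairs => // i j; rewrite (edgeC (d i)) (edgeC (e i)).
Qed.

(** Cuts [F] down to a part inside [X] that still joins [x] to [t]: [F] is connected and leaves [X],
    and every edge by which it does so starts at [t], so the component of [F :&: X] at [x] cannot
    stop before [t]. *)
Lemma reach F X x y t : conn F -> x \in F -> x \in X -> y \in F -> y \notin X ->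
  (forall u v, u \in X -> v \in F -> v \notin X -> edge u v -> u = t) ->
  exists C : {set G}, [/\ conn C, x \in C, t \in C & C \subset F :&: X].
Proof.
move=> cF xF xX yF yX out; have xFX : x \in F :&: X by rewrite inE xF.
have sub := component_sub xFX; exists (component (F :&: X) x); split=> //.
- exact: conn_component.
- exact: component_refl.
have yC : y \notin component (F :&: X) x.
  by apply: contra yX => /(subsetP sub); rewrite inE => /andP[].
have [u [v [uF uC vF vC uv]]] := conn_exit cF xF (component_refl _ _) yF yC.
have uX : u \in X by have := subsetP sub _ uC; rewrite inE => /andP[].
rewrite -(out u v) //; apply: contra vC => vX.
by apply: component_closed uv; rewrite // inE vF.
Qed.

End Only.

(** * Ramsey's theorem *)

Section Ramsey.
Variable C : finType.

Lemma sum_count (T : eqType) (f : T -> C) (s : seq T) :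
  \sum_i count (fun x => f x == i) s = size s.
Proof.
elim: s => [|x s IH] /=; first by rewrite big1.
rewrite big_split /= IH (bigD1 (f x)) //= eqxx big1 ?addn0 //.
by move=> i; rewrite eq_sym => /negPf->.
Qed.

Lemma pigeonhole (T : eqType) (f : T -> C) (s : seq T) n : #|C| * n < size s ->
  exists i, n <= count (fun x => f x == i) s.
Proof.
move=> lt_s; apply/existsP; apply: contraLR lt_s; rewrite negb_exists => /forallP lt_n.
rewrite -leqNgt -(sum_count f) -sum_nat_const; apply: leq_sum => i _.
by apply: ltnW; rewrite ltnNge.
Qed.

(** The second component of an entry is the color of every pair that starts there. By pigeonhole,
    some color class of the pairs from the head is long enough for the recursion. *)
Lemma ramsey_min m : exists N, forall (T : eqType) (c : T -> T -> C) (s : seq T),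
  N <= size s -> exists l : seq (T * C),
    [/\ subseq (map fst l) s, size l = m & pairwise (fun u v => c u.1 v.1 == u.2) l].
Proof.
elim: m => [|m [N IH]]; first by exists 0 => T c s _; exists [::]; rewrite sub0seq.
exists (#|C| * N).+2 => T c [|x s] //= lt_s; rewrite ltnS in lt_s.
have [i le_N] := @pigeonhole _ (c x) _ _ lt_s.
have [|l [sub_l size_l pw_l]] := IH T c [seq y <- s | c x y == i].
  by rewrite size_filter.
exists ((x, i) :: l); split=> /=; last 2 first.
- by rewrite size_l.
- rewrite pw_l andbT; apply/allP=> -[y j] y_l /=.
  have /(mem_subseq sub_l) : y \in map fst l by apply/mapP; exists (y, j).
  by rewrite mem_filter => /andP[].
- by rewrite eqxx; apply: subseq_trans sub_l (filter_subseq _ _).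
Qed.

(** Pigeonhole on the carried colors. The coloring may be asymmetric, since a pair is colored in the
    order of the list and [subseq] keeps this order. *)
Lemma ramsey n : exists N, forall (T : eqType) (c : T -> T -> C) (s : seq T),
  N <= size s -> exists i s',
    [/\ subseq s' s, size s' = n & pairwise (fun x y => c x y == i) s'].
Proof.
have [N HN] := ramsey_min (#|C| * n).+1; exists N => T c s /(HN T c)[l [sub_l size_l pw_l]].
have [|i le_n] := @pigeonhole _ (fun u : T * C => u.2) l n; first by rewrite size_l.
exists i, (map fst (take n [seq u <- l | u.2 == i])).
have sub1 : subseq (take n [seq u <- l | u.2 == i]) l.
  exact: subseq_trans (take_subseq _ _) (filter_subseq _ _).
split.
- exact: subseq_trans (map_subseq _ sub1) sub_l.
- by rewrite size_map size_takel // size_filter.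
- rewrite pairwise_map.
  have : pairwise (fun u v => c u.1 v.1 == u.2) (take n [seq u <- l | u.2 == i]).
    exact: subseq_pairwise sub1 pw_l.
  apply: (sub_in_pairwise (P := [pred u | u.2 == i])) => [u v /= /eqP <- _ //|].
  by apply/allP=> u /mem_take; rewrite mem_filter => /andP[].
Qed.

End Ramsey.

Lemma pairwise_in (T : eqType) (R : rel T) (s : seq T) x y : pairwise R s ->
  x \in s -> y \in s -> x != y -> R x y || R y x.
Proof.
elim: s => //= z s IH /andP[/allP Rz /IH{}IH]; rewrite !inE.
case/predU1P=> [->|xs] /predU1P[->|ys]; rewrite ?eqxx // => xy.
- by rewrite Rz.
- by rewrite (Rz x) // orbT.
- exact: IH.
Qed.

(** * Bounded clique number and [K_{2,3}] *)

Section Cliques.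
Variable G : sgraph.
Variable t : nat.
Hypothesis no_clique : ~ (exists K : {set G}, clique K /\ #|K| = t).

Lemma no_clique_seq (s : seq G) : t <= size s -> pairwise (@edge G) s -> False.
Proof.
move=> le_t pw; have pw' := subseq_pairwise (take_subseq s t) pw.
apply: no_clique; exists [set x in take t s]; split.
  move=> x y; rewrite !inE => xs ys xy.
  by have := pairwise_in pw' xs ys xy; rewrite (edgeC y) orbb.
rewrite cardsE; have /card_uniqP-> : uniq (take t s); last by rewrite size_takel.
by apply: pairwise_uniq pw' => x; rewrite edge_irrefl.
Qed.

Lemma no_clique_set (K : {set G}) : #|K| = t ->
  exists x y, [/\ x \in K, y \in K, x != y & ~~ edge x y].
Proof.
move=> cardK.
have [/forall_inP cl|/forall_inPn[x xK /forall_inPn[y yK]]] :=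
    boolP [forall x in K, forall y in K, (x != y) ==> edge x y].
  case: no_clique; exists K; split=> // x y xK yK xy.
  by have /forall_inP/(_ y yK)/implyP/(_ xy) := cl x xK.
by rewrite negb_imply => /andP[xy nxy]; exists x, y.
Qed.

Hypothesis tpf : theta_prism_free G.

Lemma no_K23 (x y : G) (s : seq G) : x != y -> ~~ edge x y -> 2 < size s -> uniq s ->
  pairwise (fun u v => ~~ edge u v) s -> {in s, forall z, edge x z && edge y z} -> False.
Proof.
move=> xy nxy lt2 uq pw xys.
have lt_s (i : 'I_3) : i < size s by apply: leq_trans (ltn_ord i) lt2.
apply: (no_theta tpf (x := x) (y := y) (H := fun i => [set nth x s i])) => //.
  move=> i; have /andP[xz yz] := xys _ (mem_nth x (lt_s i)); split; rewrite ?nbr1 ?inE //.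
  - exact: conn1.
  - by apply: contraTneq xz => <-; rewrite edge_irrefl.
  - by apply: contraTneq yz => <-; rewrite edge_irrefl.
move=> i j ij; rewrite sep11.
have neq : nth x s i != nth x s j by rewrite nth_uniq.
have := pairwise_in pw (mem_nth x (lt_s i)) (mem_nth x (lt_s j)) neq.
by rewrite neq (edgeC (nth x s j)) orbb.
Qed.

End Cliques.

Lemma component_sep (G : sgraph) (X : {set G}) x y : x \in X -> y \in X ->
  y \notin component X x -> sep (component X x) (component X y).
Proof.
move=> xX yX yC; apply/sepP=> u v uC vC.
have vX := subsetP (component_sub yX) _ vC.
have v_notC : v \notin component X x.
  apply: contra yC; rewrite !inE => /connect_trans; apply.
  by rewrite (sym_connect_sym (@relin_sym _ X)); rewrite inE in vC.
split; first by apply: contraNneq v_notC => <-.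
by apply: contra v_notC => uv; apply: component_closed uv.
Qed.

Lemma pairwise4 (T : Type) (R : rel T) x1 x2 x3 x4 s : pairwise R [:: x1, x2, x3, x4 & s] ->
  [/\ R x1 x2, R x1 x3, R x1 x4, R x2 x3 & R x2 x4] /\ R x3 x4.
Proof.
rewrite /= => /andP[/and4P[r12 r13 r14 _] /andP[/and3P[r23 r24 _] /andP[/andP[r34 _] _]]].
by [].
Qed.

Section NonNeighbours.
Variable G : sgraph.
Implicit Types (x y z : G) (X : {set G}).

Definition nonnbrs (X : {set G}) z := [set x in X | ~~ edge z x].

Lemma nonnbrs_sub X z : nonnbrs X z \subset X.
Proof. by apply/subsetP=> x; rewrite inE => /andP[]. Qed.

Lemma nonnbrs_edge X z x : x \in nonnbrs X z -> ~~ edge z x.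
Proof. by rewrite inE => /andP[]. Qed.

(** Since [z |: X] is connected, some edge leaves the component. Its outer end lies in [X], because
    [z] has no neighbor in the component, and is adjacent to [z], as otherwise it would belong to
    the component. *)
Lemma nonnbrs_exit X z l : conn (z |: X) -> z \notin X -> l \in nonnbrs X z ->
  exists x, [/\ x \in X, edge z x, x \notin component (nonnbrs X z) l
              & nbr x (component (nonnbrs X z) l)].
Proof.
move=> cX zX lX; pose K := component (nonnbrs X z) l.
have KN : K \subset nonnbrs X z := component_sub lX.
have KX : K \subset X := subset_trans KN (nonnbrs_sub X z).
have lK : l \in K := component_refl _ _.
have [||||u [v [_ uK vX vK uv]]] := @conn_exit _ (z |: X) K l z cX.
- by rewrite in_setU1 (subsetP KX) ?orbT.
- by [].
- exact: setU11.
- by apply: contra zX; apply: (subsetP KX).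
have zu := nonnbrs_edge (subsetP KN _ uK).
have vz : v != z by apply: contraNneq zu => <-; rewrite edgeC.
move: vX; rewrite in_setU1 (negPf vz) /= => vX.
exists v; split=> //; last by apply: nbr_intro uK _; rewrite edgeC.
by apply: contraNT vK => zv; apply: component_closed uv; rewrite // inE vX.
Qed.

End NonNeighbours.

(** * Leaves attached to a common vertex *)

Section Apex.
Variable G : sgraph.
Hypothesis tpf : theta_prism_free G.
Implicit Types (x y z : G) (X Y Z : {set G}).

Variables (a : G) (D A : {set G}).
Hypothesis aD : a \notin D.
Hypothesis edge_a : {in D, forall v, edge a v = (v \in A)}.
Hypothesis subAD : A \subset D.
Hypothesis leaf1 : {in A & D &, forall l x y, edge l x -> edge l y -> x = y}.

(** A connected set from which [a] is reached through a leaf, that is, a possible third of a theta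
    ending at [a]. *)
Definition leg X := [&& X \subset D, conn X & [exists x in X, x \in A]].

Lemma legP X : reflect [/\ X \subset D, conn X & exists2 x, x \in X & x \in A] (leg X).
Proof. by apply: (iffP and3P) => -[sX cX /exists_inP]. Qed.

(* The three connected sets give three paths from c to neighbors of a, hence a
   theta with ends c and a. *)
Lemma no_claw c (B : 'I_3 -> {set G}) : c \in D ->
  (forall i, [/\ leg (B i), c \notin B i & nbr c (B i)]) ->
  (forall i j, i != j -> sep (B i) (B j)) -> False.
Proof.
move=> cD BP sepB.
have cA : c \notin A.
  apply/negP=> cA; have [/legP[s0 _ _] _ /nbrP[x x0 cx]] := BP o0.
  have [/legP[s1 _ _] _ /nbrP[y y1 cy]] := BP o1.
  have xy := leaf1 cA (subsetP s0 _ x0) (subsetP s1 _ y1) cx cy.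
  by have := sep_notin (sepB o0 o1 isT) x0; rewrite xy y1.
apply: (no_theta tpf (x := c) (y := a) (H := B)) => //.
- by apply: contraNneq aD => <-.
- by rewrite edgeC edge_a.
- move=> i; have [/legP[sB cB [l lB lA]] cB' nB] := BP i; split=> //.
    by apply: contra aD; apply: (subsetP sB).
  by apply: nbr_intro lB _; rewrite edge_a // (subsetP subAD).
Qed.

Lemma no_claw3 c B1 B2 B3 : c \in D -> leg B1 -> leg B2 -> leg B3 ->
  c \notin B1 -> c \notin B2 -> c \notin B3 ->
  nbr c B1 -> nbr c B2 -> nbr c B3 ->
  sep B1 B2 -> sep B1 B3 -> sep B2 B3 -> False.
Proof.
move=> cD l1 l2 l3 c1 c2 c3 n1 n2 n3 s12 s13 s23.
apply: (@no_claw c (tri3 B1 B2 B3)) => //; first exact: ord3_ind.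
by apply: ord3_pairs => // i j; rewrite sepC.
Qed.

Lemma tri_weight (E : 'I_3 -> {set G}) i X :
  \sum_j #|if j == i then X else E j| + #|E i| = \sum_j #|E j| + #|X|.
Proof.
rewrite (bigD1 i) //= eqxx (bigD1 (F := fun j => #|E j|) i) //=.
rewrite (eq_bigr (fun j => #|E j|)); first by rewrite addnC addnCA addnC.
by move=> j /negPf->.
Qed.

(** One end of a prism: the corners [d i] of a triangle lead to leaves inside the [F i], and the
    triangle carries all edges between these sets. *)
Definition triad (F0 : 'I_3 -> {set G}) (d : 'I_3 -> G) (F : 'I_3 -> {set G}) :=
  [/\ forall i, [/\ conn (F i), d i \in F i, F i \subset F0 i & exists2 l, l \in F i & l \in A],
      forall i j, i != j -> edge (d i) (d j)
    & forall i j, i != j -> {in F i & F j, forall x y,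
         x != y /\ (edge x y -> x = d i /\ y = d j)}].

(* Minimize 3 |B| + 2 sum |E i|: then only one vertex of each E i touches B, and
   each non-cut vertex of B is the only one touching some E i.  Moving it from B to
   that E i would decrease the weight, so it must touch a second E k.  Hence B has
   exactly two non-cut vertices, both adjacent to the same vertex of the third set. *)
Lemma triad_exists (B : {set G}) (E : 'I_3 -> {set G}) :
  B \subset D -> conn B ->
  (forall i, [/\ E i \subset D, conn (E i), [disjoint B & E i],
                 exists2 l, l \in E i & l \in A & exists2 u, u \in B & nbr u (E i)]) ->
  (forall i j, i != j -> sep (E i) (E j)) ->
  (forall d F, triad (fun i => E i :|: B) d F -> False) -> False.
Proof.
(* With these weights a deletion from [E i] gains 2, a deletion from [B] gains 3, and a move from
   [B] to [E i] still gains 1. *)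
have [n] := ubnP (3 * #|B| + 2 * \sum_i #|E i|); elim: n B E => // n IH B E lt_n.
move=> BD cB EP sepE noF.
(* A triad in smaller sets is one in the given sets as long as each [E' i :|: B'] stays inside
   [E i :|: B]. *)
have {}IH (B' : {set G}) (E' : 'I_3 -> {set G}) : 3 * #|B'| + 2 * \sum_i #|E' i| < 3 * #|B| + 2 * \sum_i #|E i| ->
    conn B' -> B' \subset B -> (forall i, E' i :|: B' \subset E i :|: B) ->
    (forall i, [/\ conn (E' i), [disjoint B' & E' i],
                 exists2 l, l \in E' i & l \in A & exists2 u, u \in B' & nbr u (E' i)]) ->
    (forall i j, i != j -> sep (E' i) (E' j)) -> False.
  move=> lt' cB' sB' sE' EP' sepE'; apply: (IH B' E') => //.
  - by apply: leq_trans lt' _; rewrite -ltnS.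
  - exact: subset_trans BD.
  - move=> i; have [c1 c2 c3 c4] := EP' i; split=> //.
    apply: subset_trans (subset_trans (sE' i) _); first exact: subsetUl.
    by rewrite subUset BD andbT; have [] := EP i.
  - move=> d F [FP tri sF]; apply: (noF d F); split=> // i.
    by have [h1 h2 h3 h4] := FP i; split=> //; apply: subset_trans (sE' i).
(* If [E i] has several vertices, [x] is a non-cut vertex other than some leaf. If a vertex of [E i]
   besides [x] touched [B], then [x] could be deleted. *)
have touchE i : exists x, [/\ x \in E i, {in B & E i, forall u y, edge u y -> y = x}
    & 1 < #|E i| -> conn (E i :\ x) /\ exists2 l, l \in E i :\ x & l \in A].
  have [ED cE dE [l lE lL] [u uB uE]] := EP i.
  have [leE|gtE] := leqP #|E i| 1.
    exists l; split=> // v y _ yE _; exact: (card_le1_eqP leE l y).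
  have [x [xE xl cx]] := conn_noncut cE lE gtE; exists x; split=> //; last first.
    by move=> _; split=> //; exists l; rewrite // !inE eq_sym xl.
  move=> v y vB yE vy; apply/eqP/negPn/negP=> yx.
  apply: (IH B (fun j => if j == i then E i :\ x else E j)) => //.
  - rewrite ltn_add2l ltn_pmul2l // -(ltn_add2r #|E i|) tri_weight ltn_add2l.
    by rewrite (cardsD1 x (E i)) xE.
  - by move=> j; apply: setSU; case: eqP => // ->; apply: subD1set.
  - move=> j; have [_ h1 h2 h3 h4] := EP j; case: eqP => // _; split=> //.
    + by rewrite disjoint_sym (disjointWl (subD1set _ _)) // disjoint_sym.
    + by exists l; rewrite // !inE eq_sym xl.
    + by exists v => //; apply: nbr_intro vy; rewrite !inE yx.
  - move=> j k jk; have := sepE j k jk; apply: sepS; case: eqP => // ->; exact: subD1set.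
(* Otherwise every [E i] would be touched from [B :\ v], and [v] could be deleted. *)
have touchB v : v \in B -> 1 < #|B| -> conn (B :\ v) ->
    exists i, {in B, forall u, nbr u (E i) -> u = v}.
  move=> vB gtB cv.
  have [/existsP[i /forall_inP Hi]|/existsPn noi] :=
      boolP [exists i, [forall u in B, nbr u (E i) ==> (u == v)]].
    by exists i => u uB /(implyP (Hi u uB))/eqP.
  exfalso; apply: (IH (B :\ v) E) => //.
  - by rewrite ltn_add2r ltn_pmul2l // (cardsD1 v B) vB.
  - exact: subD1set.
  - by move=> i; apply: setUS; apply: subD1set.
  - move=> i; have [_ h1 h2 h3 h4] := EP i; split=> //.
      by rewrite (disjointWl (subD1set _ _)).
    have /forall_inPn[u uB] := noi i; rewrite negb_imply => /andP[un uv].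
    by exists u; rewrite // !inE uv.
have notE i v : v \in B -> v \notin E i.
  by have [_ _ dE _ _] := EP i => vB; rewrite (disjointFr dE vB).
have [leB|gtB] := leqP #|B| 1.
  have [_ _ _ _ [c cB0 _]] := EP o0.
  apply: (@no_claw c E) => //; first exact: (subsetP BD).
  move=> i; have [ED cE dE [l lE lL] [u uB uE]] := EP i; split.
  - by apply/legP; split=> //; exists l; rewrite // (subsetP (LA i)).
  - exact: notE.
  - by rewrite (card_le1_eqP leB u c uB cB0).
have [v1 [v2 [v12 v1B v2B cv1 cv2]]] := conn_two_noncut cB gtB.
have [i Hi] := touchB v1 v1B gtB cv1; have [j Hj] := touchB v2 v2B gtB cv2.
have nv k v : {in B, forall u, nbr u (E k) -> u = v} -> nbr v (E k).
  by have [_ _ _ _ [u uB uE]] := EP k => /(_ u uB uE) <-.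
have n1 := nv _ _ Hi; have n2 := nv _ _ Hj.
have ij : i != j.
  by apply: contraNneq v12 => eq_ij; apply/eqP/Hj; rewrite -?eq_ij.
have [k [ki kj all_ijk]] := ord3_third ij.
(* If [v] did not touch [E k], it would be separated from both other sets and could move to [E i'].
   The rest of [B] would still touch all three sets, the enlarged one because [B] is connected. *)
have move_touch v v' i' j' : v \in B -> v' \in B -> v != v' -> conn (B :\ v) ->
    {in B, forall u, nbr u (E i') -> u = v} -> {in B, forall u, nbr u (E j') -> u = v'} ->
    k != i' -> (forall l, [\/ l = i', l = j' | l = k]) -> nbr v (E k).
  move=> vB v'B vv' cv H H' ki' all_l; apply: contraT => nvk; exfalso.
  have ni := nv _ _ H; have nj := nv _ _ H'.
  have nvj : ~~ nbr v (E j') by apply: contra vv' => /(H' v vB)->.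
  have sv l : l != i' -> sep [set v] (E l).
    by move=> li; rewrite sep1 notE //; case: (all_l l) => e; rewrite e //; rewrite e eqxx in li.
  apply: (IH (B :\ v) (fun l => if l == i' then v |: E i' else E l)) => //.
  - have hw : \sum_l #|if l == i' then v |: E i' else E l| = (\sum_l #|E l|).+1.
      by apply: (@addIn #|E i'|); rewrite tri_weight cardsU1 notE // add1n addSnnS.
    rewrite hw (cardsD1 v B) vB /=; move: (\sum_l #|E l|) #|B :\ v|; clear=> p q; lia.
  - exact: subD1set.
  - move=> l; apply/subsetP=> x; case: eqP => [->|_]; rewrite !inE.
      by case/orP=> [/orP[/eqP->|->]|/andP[_ ->]]; rewrite ?vB ?orbT.
    by case/orP=> [->|/andP[_ ->]]; rewrite ?orbT.
  - move=> l; have [_ h1 h2 [l' h3 h3'] [u uB uE]] := EP l.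
    have dis : [disjoint B :\ v & E l] by rewrite (disjointWl (subD1set _ _)).
    have [li|li] := eqVneq l i'.
      subst l; split.
      + exact: conn_add.
      + rewrite disjoint_subset; apply/subsetP=> y yB; rewrite !inE negb_or.
        by rewrite (disjointFr dis yB) andbT; move: yB; rewrite !inE => /andP[].
      + by exists l'; rewrite // !inE h3 orbT.
      + have [y yB vy] := nbrP _ _ (conn_nbr cB vB v'B vv').
        by exists y => //; apply: nbr_intro (setU11 _ _) _; rewrite edgeC.
    split=> //; first by exists l'.
    case: (all_l l) => e; first by rewrite e eqxx in li.
      by exists v'; rewrite ?e // !inE eq_sym vv'.
    exists u => //; rewrite !inE uB andbT; apply: contraNneq nvk => <-.
    by rewrite -e.
  - move=> l m lm; case: (eqVneq l i') => li; case: (eqVneq m i') => mi.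
    + by rewrite li mi eqxx in lm.
    + by rewrite sepUl sv // -li; apply: sepE.
    + by rewrite sepUr sepC sv // -mi; apply: sepE.
    + exact: sepE.
have nk1 : nbr v1 (E k) by apply: (move_touch v1 v2 i j).
have nk2 : nbr v2 (E k).
  apply: (move_touch v2 v1 j i) => //; first by rewrite eq_sym.
  by move=> l; case: (all_ijk l); [constructor 2 | constructor 1 | constructor 3].
have [x [xE xuniq cx]] := touchE k.
have touch_x v : v \in B -> nbr v (E k) -> edge v x.
  by move=> vB /nbrP[y yE vy]; rewrite -(xuniq v y vB yE vy).
have e1 := touch_x _ v1B nk1; have e2 := touch_x _ v2B nk2.
have ji : j != i by rewrite eq_sym.
have n1j : ~~ nbr v1 (E j) by apply: contra v12 => /(Hj v1 v1B)->.
have n2i : ~~ nbr v2 (E i) by rewrite eq_sym in v12; apply: contra v12 => /(Hi v2 v2B)->.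
have [e12|e12] := boolP (edge v1 v2).
  pose d l := if l == i then v1 else if l == j then v2 else x.
  pose F l := if l == i then v1 |: E i else if l == j then v2 |: E j else E k.
  have di : d i = v1 by rewrite /d eqxx.
  have dj : d j = v2 by rewrite /d (negPf ji) eqxx.
  have dk : d k = x by rewrite /d (negPf ki) (negPf kj).
  have Fi : F i = v1 |: E i by rewrite /F eqxx.
  have Fj : F j = v2 |: E j by rewrite /F (negPf ji) eqxx.
  have Fk : F k = E k by rewrite /F (negPf ki) (negPf kj).
  have pairs (R : 'I_3 -> 'I_3 -> Prop) : (forall l m, R l m -> R m l) ->
     R i j -> R i k -> R j k -> forall l m, l != m -> R l m.
    move=> Rs Rij Rik Rjk l m.
    by case: (all_ijk l) => ->; case: (all_ijk m) => -> //; rewrite ?eqxx // => _; apply: Rs.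
  apply: (noF d F); split.
  - have cE l : conn (E l) by have [] := EP l.
    have lE l : exists2 y, y \in E l & y \in A by have [] := EP l.
    move=> l; case: (all_ijk l) => ->; rewrite ?(di, dj, dk, Fi, Fj, Fk).
    + split; [exact: conn_add|exact: setU11| |].
        by rewrite subUset sub1set inE v1B orbT subsetUl.
      by have [y yE yL] := lE i; exists y; rewrite // !inE yE orbT.
    + split; [exact: conn_add|exact: setU11| |].
        by rewrite subUset sub1set inE v2B orbT subsetUl.
      by have [y yE yL] := lE j; exists y; rewrite // !inE yE orbT.
    + by split=> //; apply: subsetUl.
  - apply: pairs; rewrite ?(di, dj, dk) //.
    by move=> l m; rewrite edgeC.
  - apply: pairs; rewrite ?(di, dj, dk, Fi, Fj, Fk).
    + move=> l m H y z yF zF; have [h1 h2] := H z y zF yF.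
      by rewrite eq_sym edgeC; split=> // /h2[].
    + move=> y z /setU1P[->|yE] /setU1P[->|zE].
      * by rewrite v12.
      * rewrite (contraTneq _ zE); last by move=> <-; apply: notE.
        by split=> // v1z; case/negP: n1j; apply: nbr_intro v1z.
      * rewrite eq_sym (contraTneq _ yE); last by move=> <-; apply: notE.
        by split=> // yv2; case/negP: n2i; apply: nbr_intro yE _; rewrite edgeC.
      * have /sepP/(_ y z yE zE)[-> /negP] := sepE i j ij; by split.
    + move=> y z /setU1P[->|yE] zE.
      * rewrite (contraTneq _ zE); last by move=> <-; apply: notE.
        by split=> // v1z; split=> //; apply: xuniq v1z.
      * have ik : i != k by rewrite eq_sym.
        have /sepP/(_ y z yE zE)[-> /negP] := sepE i k ik; by split.
    + move=> y z /setU1P[->|yE] zE.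
      * rewrite (contraTneq _ zE); last by move=> <-; apply: notE.
        by split=> // v1z; split=> //; apply: xuniq v1z.
      * have jk : j != k by rewrite eq_sym.
        have /sepP/(_ y z yE zE)[-> /negP] := sepE j k jk; by split.
(* With [v1] and [v2] non-adjacent, [x] is the center of a theta to [a], the rest of [E k] being the
   third leg. This rest contains a leaf, since [E k] cannot consist of one leaf adjacent to both
   [v1] and [v2]. *)
have [EkD cEk _ [lk lkE lkL] _] := EP k.
have [EiD cEi _ [li liE liL] _] := EP i.
have [EjD cEj _ [lj ljE ljL] _] := EP j.
have [leE|gtE] := leqP #|E k| 1.
  have xA : x \in A by rewrite (card_le1_eqP leE lk x lkE xE).
  have := leaf1 xA (subsetP BD _ v1B) (subsetP BD _ v2B).
  by rewrite !(edgeC x) e1 e2 => /(_ isT isT) eq12; rewrite eq12 eqxx in v12.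
have [cEx [l lE lL]] := cx gtE.
have xB : x \notin B by have [_ _ dE _ _] := EP k; rewrite (disjointFl dE xE).
have ik : i != k by rewrite eq_sym.
have jk : j != k by rewrite eq_sym.
have vEk v : v \in B -> sep [set v] (E k :\ x).
  move=> vB; rewrite sep1 !inE negb_and notE ?orbT //=.
  apply/nbrP=> -[y /setD1P[yx yE] vy]; case/eqP: yx; exact: xuniq vy.
apply: (@no_claw3 x (v1 |: E i) (v2 |: E j) (E k :\ x)).
- exact: (subsetP EkD).
- apply/legP; split; [by rewrite subUset sub1set (subsetP BD) | exact: conn_add|].
  by exists li; rewrite ?inE ?liE ?orbT.
- apply/legP; split; [by rewrite subUset sub1set (subsetP BD) | exact: conn_add|].
  by exists lj; rewrite ?inE ?ljE ?orbT.
- apply/legP; split=> //; last by exists l.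
  exact: subset_trans (subD1set _ _) EkD.
- rewrite !inE negb_or (contraNneq _ xB) => [|->//].
  by apply: (sep_notin (sepE k i ki)).
- rewrite !inE negb_or (contraNneq _ xB) => [|->//].
  by apply: (sep_notin (sepE k j kj)).
- by rewrite !inE eqxx.
- by apply: nbr_intro (setU11 _ _) _; rewrite edgeC.
- by apply: nbr_intro (setU11 _ _) _; rewrite edgeC.
- by apply: (conn_nbr (y := l)) => //; move: lE; rewrite !inE eq_sym => /andP[].
- rewrite sepUl !sepUr sep11 v12 e12 sep1 notE //= n1j sepE // andbT.
  by rewrite sepC sep1 notE.
- rewrite sepUl vEk //=; apply: sepS (sepE i k ik) => //; exact: subD1set.
- rewrite sepUl vEk //=; apply: sepS (sepE j k jk) => //; exact: subD1set.
Qed.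

(** An induced path between two remaining vertices cannot pass through a deleted leaf, which would
    need two distinct neighbors in [D]. *)
Lemma conn_setD X (A' : {set G}) : A' \subset A -> conn X -> X \subset D -> conn (X :\: A').
Proof.
move=> sA' cX XD; apply/connP=> x y /setDP[xX xA'] /setDP[yX yA'].
have [p [ip lastp sub]] := conn_ipath cX xX yX.
rewrite -lastp; apply: walk_connect (ipath_path ip) _ => z z_in.
rewrite inE sub // andbT; apply/negP=> zA'; have zA := subsetP sA' _ zA'.
move: (z_in); rewrite inE => /predU1P[zx|z_p]; first by rewrite -zx zA' in xA'.
case/splitPr: z_p ip lastp sub {z_in} => p1 [|w p2] ip lastp sub.
  by move: lastp yA'; rewrite last_cat /= => <-; rewrite zA'.
have := ipath_path ip; rewrite cat_path /= => /and3P[_ ez /andP[zw _]].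
have [_ _ uq _] := ipath_induced ip.
have in_D v : v \in x :: p1 ++ z :: w :: p2 -> v \in D by move=> /sub/(subsetP XD).
have := leaf1 zA (in_D (last x p1) _) (in_D w _).
rewrite -cat_cons !mem_cat mem_last !inE eqxx !orbT edgeC => /(_ isT isT ez zw) eq_w.
by move: uq; rewrite -cat_cons cat_uniq /= -eq_w mem_last /= orbT !andbF.
Qed.

Lemma conn_setDA X : conn X -> X \subset D -> conn (X :\: A).
Proof. exact: conn_setD. Qed.

(** Deleting all leaves of [X] except [l] leaves a connected set, in which [l] has a neighbor. *)
Lemma leaf_touch X l c : conn X -> X \subset D -> l \in X -> l \in A ->
  c \in X -> c \notin A -> nbr l (X :\: A).
Proof.
move=> cX XD lX lA cX' cA.
have cX1 : conn (X :\: (A :\ l)) by apply: conn_setD => //; apply: subD1set.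
have lc : l != c by apply: contraNneq cA => <-.
have [||y yX1 ly] := nbrP _ _ (conn_nbr (x := l) (y := c) cX1 _ _ lc); rewrite ?inE ?eqxx ?lX //.
  by rewrite (negPf cA) andbF.
move: yX1; rewrite !inE => /and3P[yl yA yX]; apply: nbr_intro ly.
by move: yA; rewrite inE yl yX andbT.
Qed.

Lemma leaf_priv X l c x : conn X -> X \subset D -> l \in X -> l \in A ->
  c \in X -> l != c -> x \in D -> x \notin X -> sep [set x] [set l].
Proof.
move=> cX XD lX lA cX' lc xD xX; rewrite sep11; apply/andP; split.
  by apply: contraNneq xX => ->.
have /nbrP[w /setD1P[_ wX] lw] := conn_nbr cX lX cX' lc.
apply: contra xX => xl; rewrite edgeC in xl.
by rewrite (leaf1 lA xD (subsetP XD _ wX) xl lw).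
Qed.

(** A leaf of [X] adjacent to [c] would have [c] as its only neighbor in [D], although the connected
    set [X] gives it a neighbor inside [X]. *)
Lemma nbr_setDA c X b : conn X -> X \subset D -> c \in D -> c \notin X ->
  b \in X -> b \notin A -> nbr c X -> nbr c (X :\: A).
Proof.
move=> cX XD cD cX' bX bA /nbrP[y yX cy].
have [yA|yA] := boolP (y \in A); last by apply: nbr_intro cy; rewrite inE yA.
have yb : y != b by apply: contraNneq bA => <-.
have /nbrP[w /setD1P[wy wX] yw] := conn_nbr cX yX bX yb.
rewrite edgeC in cy; move: cX'.
by rewrite (leaf1 yA cD (subsetP XD _ wX) cy yw) wX.
Qed.

(** If the neighbor of [c] in [X] is a leaf, it is adjacent in [D] to [c] alone. It then differs
    from the neighbor of [c'] and is isolated in [X], against connectivity. *)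
Lemma nonleaf_ex X c c' : conn X -> X \subset D -> c \in D -> c' \in D ->
  c \notin X -> c != c' -> nbr c X -> nbr c' X -> exists2 x, x \in X & x \notin A.
Proof.
move=> cX XD cD c'D cX' cc' /nbrP[y yX cy] /nbrP[y' yX' cy'].
have [yA|yA] := boolP (y \in A); last by exists y.
have [eq_y|neq_y] := eqVneq y y'.
  case/eqP: cc'; apply: (leaf1 yA) => //; rewrite edgeC //; by rewrite eq_y.
have /nbrP[w /setD1P[_ wX] yw] := conn_nbr cX yX yX' neq_y.
case/negP: cX'; rewrite edgeC in cy.
by rewrite (leaf1 yA cD (subsetP XD _ wX) cy yw).
Qed.

Lemma two_nbrs_nonleaf c x y : c \in D -> x \in D -> y \in D -> x != y ->
  edge c x -> edge c y -> c \notin A.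
Proof. by move=> cD xD yD xy cx cy; apply: contra xy => cA; apply/eqP/(leaf1 cA). Qed.

Lemma sep_a X : X \subset D -> [disjoint X & A] -> sep [set a] X.
Proof.
move=> XD XA; rewrite sep1; apply/andP; split; first by apply: contra aD; apply: (subsetP XD).
by apply/nbrP=> -[y yX]; rewrite edge_a ?(subsetP XD) // (disjointFr XA).
Qed.

(* The hole through t1, z, U, z' and K1 has three attached paths to leaves: through
   t2 and K2, inside K1, and inside U.  By [triad_exists] each is attached by a
   triangle, and two of the three triangles are disjoint, which gives a prism. *)
Lemma no_detour U K1 K2 z z' t1 t2 b :
  leg U -> b \in U -> b \notin A -> leg K1 -> leg K2 ->
  sep U K1 -> sep U K2 -> sep K1 K2 ->
  z \in D -> z \notin U -> nbr z U -> sep [set z] K1 -> sep [set z] K2 ->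
  z' \in D -> z' \notin U -> nbr z' U -> z' \notin K1 -> nbr z' K1 -> sep [set z'] K2 ->
  sep [set z'] [set z] -> sep [set z'] [set t2] -> z' != t1 ->
  t1 \in D -> t1 \notin K1 -> nbr t1 K1 -> sep [set t1] K2 -> sep [set t1] U ->
  t2 \in D -> t2 \notin K2 -> nbr t2 K2 -> sep [set t2] K1 -> sep [set t2] U ->
  edge z t1 -> edge z t2 -> edge t1 t2 -> False.
Proof.
move=> legU bU bA legK1 legK2 sUK1 sUK2 sK12 zD zU nzU sz1 sz2.
move=> z'D z'U nz'U z'K1 nz'K1 sz'2 sz'z sz't2 z't1.
move=> t1D t1K1 nt1 st12 st1U t2D t2K2 nt2 st21 st2U zt1 zt2 t12.
have [UD cU [l0 l0U l0A]] := legP _ legU.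
have [K1D cK1 [l1 l1K l1A]] := legP _ legK1.
have [K2D cK2 [l2 l2K l2A]] := legP _ legK2.
have [cU' cK1'] : conn (U :\: A) /\ conn (K1 :\: A) by split; apply: conn_setDA.
have U'U : U :\: A \subset U := subsetDl _ _.
have K1'K1 : K1 :\: A \subset K1 := subsetDl _ _.
have nzU' : nbr z (U :\: A) by apply: (nbr_setDA (b := b)).
have nz'U' : nbr z' (U :\: A) by apply: (nbr_setDA (b := b)).
have [c cK1c cA] : exists2 x, x \in K1 & x \notin A by apply: (@nonleaf_ex _ z' t1).
have nz'K1' : nbr z' (K1 :\: A) by apply: (nbr_setDA (b := c)).
have nt1' : nbr t1 (K1 :\: A) by apply: (nbr_setDA (b := c)).
have t1t2 : t1 != t2 by apply: contraTneq t12 => ->; rewrite edge_irrefl.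
have zt1' : z != t1 by apply: contraTneq zt1 => ->; rewrite edge_irrefl.
have zt2' : z != t2 by apply: contraTneq zt2 => ->; rewrite edge_irrefl.
have t1A : t1 \notin A by apply: (@two_nbrs_nonleaf t1 z t2); rewrite // edgeC.
have t2A : t2 \notin A by apply: (@two_nbrs_nonleaf t2 z t1); rewrite // edgeC.
have zA : z \notin A by apply: (@two_nbrs_nonleaf z t1 t2).
have z'A : z' \notin A.
  have [u uU z'u] := nbrP _ _ nz'U; have [k kK z'k] := nbrP _ _ nz'K1.
  apply: (@two_nbrs_nonleaf z' u k) => //; [exact: (subsetP UD) | exact: (subsetP K1D)|].
  by apply: contraTneq uU => ->; rewrite sepC in sUK1; apply: sep_notin kK.
have disA X : [disjoint X :\: A & A] by rewrite -setI_eq0 setIDAC setD_eq0 subsetIr.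
have dis1 x : x \notin A -> [disjoint [set x] & A] by rewrite disjoints1.
have sub1D x : x \in D -> [set x] \subset D by rewrite sub1set.
have U'D : U :\: A \subset D := subset_trans U'U UD.
have K1'D : K1 :\: A \subset D := subset_trans K1'K1 K1D.
have saU' : sep [set a] (U :\: A) by apply: sep_a.
have saK1' : sep [set a] (K1 :\: A) by apply: sep_a.
have saz : sep [set a] [set z] by apply: sep_a => //; auto.
have saz' : sep [set a] [set z'] by apply: sep_a => //; auto.
have sat1 : sep [set a] [set t1] by apply: sep_a => //; auto.
have sat2 : sep [set a] [set t2] by apply: sep_a => //; auto.
have al l : l \in A -> edge a l by move=> lA; rewrite edge_a // (subsetP subAD).
have nzU'' u : u \in U -> edge t1 u -> False by move=> uU; apply/negP; apply: sep_edge st1U (set11 _) uU.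

have szt2U : sep (t2 |: K2) U by rewrite sepUl st2U sepC.
have sK2U : sep K2 U by rewrite sepC.
have sK1U : sep K1 U by rewrite sepC.
have st2K : sep (t2 |: K2) K1 by rewrite sepUl st21 sepC.
have ct2 : conn (t2 |: K2) by apply: conn_add.
have t2K2D : t2 |: K2 \subset D by rewrite subUset sub1set t2D.
have l0b : l0 != b by apply: contraNneq bA => <-.
have l1c : l1 != c by apply: contraNneq cA => <-.
have zl0 : sep [set z] [set l0] by apply: (leaf_priv (X := U) (c := b)).
have z'l0 : sep [set z'] [set l0] by apply: (leaf_priv (X := U) (c := b)).
have t1z : t1 != z by rewrite eq_sym.
have st2z' : sep [set t2] [set z'] by rewrite sepC.
have s_l0U Y : sep Y U -> sep Y [set l0] by apply: sepS => //; rewrite sub1set.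
have s_l1K Y : sep Y K1 -> sep Y [set l1] by apply: sepS => //; rewrite sub1set.
have sU' Y : sep Y U -> sep Y (U :\: A) by apply: sepS.
have sK1' Y : sep Y K1 -> sep Y (K1 :\: A) by apply: sepS.
(* First triad: inside U, towards z, z' and a leaf of U. *)
apply: (@triad_exists (U :\: A) (tri3 (z |: (t2 |: K2)) (z' |: K1) [set l0])) => //.
- apply: ord3_ind; rewrite /tri3 /=; split.
  + by rewrite subUset sub1set zD.
  + by apply: conn_add => //; rewrite nbrU nbr1 zt2.
  + apply: disjointU1r; first by rewrite !inE negb_and zU orbT.
    by apply: sep_disjoint; rewrite sepC; apply: sU'.
  + by exists l2; rewrite // !inE l2K !orbT.
  + have /nbrP[u uU zu] := nzU'; exists u => //.
    by rewrite edgeC in zu; apply: nbr_intro zu; rewrite setU11.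
  + by rewrite subUset sub1set z'D.
  + exact: conn_add.
  + apply: disjointU1r; first by rewrite !inE negb_and z'U orbT.
    by apply: sep_disjoint; rewrite sepC; apply: sU'.
  + by exists l1; rewrite // !inE l1K !orbT.
  + have /nbrP[u uU zu] := nz'U'; exists u => //.
    by rewrite edgeC in zu; apply: nbr_intro zu; rewrite setU11.
  + by rewrite sub1set (subsetP UD).
  + exact: conn1.
  + by apply: disjoint1r; rewrite !inE l0A.
  + by exists l0; rewrite ?set11.
  + have /nbrP[u uU lu] := leaf_touch cU UD l0U l0A bU bA; exists u => //.
    by rewrite nbr1 edgeC.
- apply: ord3_pairs; rewrite /tri3 /=; first by move=> i j; rewrite sepC.
  + by rewrite sepUl !sepUr st2K sz1 sepC sz'z /= sepC sepUr sz't2 sz'2.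
  + by rewrite sepUl zl0 s_l0U.
  + by rewrite sepUl z'l0 s_l0U.
move=> d' F' [F'P d'e F'o].
have [cF0 dF0 sF0 [m0 m0F m0A]] := F'P o0.
have [cF1 dF1 sF1 [m1 m1F m1A]] := F'P o1.
have [cF2 dF2 sF2 [m2 m2F m2A]] := F'P o2.
rewrite /tri3 /= in sF0 sF1 sF2.
have subF2 : F' o2 \subset U by apply: subset_trans sF2 _; rewrite subUset sub1set l0U.
have l0F2 : l0 \in F' o2.
  by move: (subsetP sF2 _ m2F); rewrite !inE m2A orbF => /eqP <-.
(* A corner beyond [z] or [z'], in [t2 |: K2] or in [K1], would have no neighbor among the possible
   places of another corner. *)
have d0X : d' o0 \in z |: (U :\: A).
  move: (subsetP sF0 _ dF0); rewrite -setUA (setUC (t2 |: K2)) setUA => /setUP[//|dK].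
  move: (subsetP sF1 _ dF1) => d1X.
  have /negP[] : ~~ edge (d' o0) (d' o1); last exact: d'e.
  apply: sep_edge dK d1X; rewrite !sepUr st2K sU' // sepUl st2z' sepC sz'2 //.
have d1X : d' o1 \in z' |: (U :\: A).
  move: (subsetP sF1 _ dF1); rewrite -setUA (setUC K1) setUA => /setUP[//|dK].
  have /negP[] : ~~ edge (d' o0) (d' o1); last exact: d'e.
  by apply: sep_edge d0X dK; rewrite sepUl sz1; apply: sepS sUK1.
(* [reach] keeps a part of [F' o0] joining the corner to [z] that avoids [t2] and [K2]; [C2] is
   obtained likewise. *)
have [C1 [cC1 dC1 zC1 subC1]] : exists C : {set G},
    [/\ conn C, d' o0 \in C, z \in C & C \subset F' o0 :&: (z |: (U :\: A))].
  apply: (reach cF0 dF0 d0X m0F).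
    by rewrite !inE negb_or m0A andbT; apply: contraTneq m0A => ->.
  move=> u v uX vF vX uv; move: uX; rewrite in_setU1 => /predU1P[//|uU].
  move: (subsetP sF0 _ vF); rewrite -setUA (setUC (t2 |: K2)) setUA inE (negPf vX) /= => vK.
  by case/negP: (sep_edge szt2U vK (subsetP U'U _ uU)); rewrite edgeC.
have [C2 [cC2 dC2 z'C2 subC2]] : exists C : {set G},
    [/\ conn C, d' o1 \in C, z' \in C & C \subset F' o1 :&: (z' |: (U :\: A))].
  apply: (reach cF1 dF1 d1X m1F).
    by rewrite !inE negb_or m1A andbT; apply: contraTneq m1A => ->.
  move=> u v uX vF vX uv; move: uX; rewrite in_setU1 => /predU1P[//|uU].
  move: (subsetP sF1 _ vF); rewrite -setUA (setUC K1) setUA inE (negPf vX) /= => vK.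
  by case/negP: (sep_edge sK1U vK (subsetP U'U _ uU)); rewrite edgeC.
move: subC1 subC2; rewrite !subsetI => /andP[C1F C1X] /andP[C2F C2X].
have ca : conn (a |: F' o2) by apply: conn_add => //; apply: nbr_intro l0F2 _; apply: al.
have sat2K : sep [set a] (t2 |: K2) -> False by move=> s; have := sep_edge s (set11 a) (setU1r _ l2K); rewrite al.
(* If [z] is not a corner, the new triangle is disjoint from the triangle [z], [t1], [t2]. The third
   path of this prism goes from [d' o2] to a leaf of [U], through [a], and back through [K2] to
   [t2]. *)
have [z_d0|z_d0] := eqVneq (d' o0) z; last first.
  apply: (@no_prism3 _ tpf (d' o1) (d' o0) (d' o2) t1 z t2
    (t1 |: ((K1 :\: A) :|: C2)) C1 ((a |: F' o2) :|: (t2 |: K2))).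
  - split=> //.
    + apply: contraTneq d1X => ->; rewrite !inE negb_or eq_sym z't1 /= negb_and.
      by rewrite (sep_notin st1U) ?set11 ?orbT.
    + by apply: contraTneq (subsetP subF2 _ dF2) => ->; rewrite (sep_notin st2U) ?set11.
  - by split; apply: d'e.
  - by split; rewrite // edgeC.
  - split=> //.
    + apply: conn_add; last by rewrite nbrU nt1'.
      have /nbrP[k kK zk] := nz'K1'; rewrite edgeC in zk.
      by apply: (connU (x := k) (y := z')); rewrite ?zk ?orbT.
    + apply: (connU (x := a) (y := l2)); rewrite ?al ?orbT ?setU11 //.
      by rewrite !inE l2K orbT.
  - by split; rewrite // !inE ?dC2 ?dF2 ?orbT.
  - by split; rewrite // !inE ?eqxx ?orbT.
  - apply: onlyUl; last (apply: onlyUl; last (apply: onlyS (F'o o1 o0 _) _ => //; by left)).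
    + apply: (onlyS (subxx _) C1X (R := two (d' o1) (d' o0) t1 z)) => //; apply: onlyUr.
        by apply: only1 => // _; right.
      by apply: only_sep; apply: sU'.
    + apply: only_sep; apply: (sepS (subxx _) C1X); rewrite sepUr; apply/andP; split.
        by apply: (sepS K1'K1 (subxx _)); rewrite sepC.
      by apply: sepS sK1U.
  - apply: onlyUl; last apply: onlyUl.
    + apply: onlyUr; apply: onlyUr.
      * by apply: only_sep; rewrite sepC.
      * by apply: only_sep; apply: sepS st1U.
      * by apply: only1 => // _; right.
      * exact: only_sep.
    + apply: only_sep; rewrite !sepUr; apply/andP; split; apply/andP; split.
      * by rewrite sepC.
      * by apply: sepS sK1U.
      * by rewrite sepC; apply: sK1'.
      * by apply: sepS sK12.
    + apply: onlyUr; apply: onlyUr.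
      * by apply: only_sep; apply: (sepS C2X (subxx _)); rewrite sepC sepUr saz'.
      * by apply: onlyS (F'o o1 o2 _) _ => //; left.
      * apply: only_sep; apply: (sepS C2X (subxx _)); rewrite sepUl sz't2 sepC; exact: sU'.
      * by apply: only_sep; apply: (sepS C2X (subxx _)); rewrite sepUl sz'2; apply: sepS sUK2.
  - apply: onlyUr; apply: onlyUr.
    + by apply: only_sep; apply: (sepS C1X (subxx _)); rewrite sepC sepUr saz.
    + by apply: onlyS (F'o o0 o2 _) _ => //; left.
    + apply: (onlyS C1X (subxx _) (R := two (d' o0) (d' o2) z t2)) => //; apply: onlyUl.
        by apply: only1 => // _; right.
      by apply: only_sep; rewrite sepC; apply: sU'.
    + by apply: only_sep; apply: (sepS C1X (subxx _)); rewrite sepUl sz2; apply: sepS sUK2.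

have d1U : d' o1 \in U :\: A.
  move: d1X; rewrite in_setU1 => /predU1P[d1z'|//].
  have := d'e o0 o1 isT; rewrite z_d0 d1z' => zz'.
  by case/negP: (sep_edge sz'z (set11 _) (set11 _)); rewrite edgeC.
have l1K' : l1 \notin K1 :\: A by rewrite inE l1A.
have t1l1 : t1 != l1 by apply: contraNneq t1A => ->.
have sBU : sep (t1 |: (K1 :\: A)) U by rewrite sepUl st1U; apply: sepS sK1U.
(* Second triad: inside K1 and t1, towards t2, a leaf of K1, and z'. *)
apply: (@triad_exists (t1 |: (K1 :\: A)) (tri3 (t2 |: K2) [set l1] (z' |: U))).
- by rewrite subUset sub1set t1D.
- exact: conn_add.
- apply: ord3_ind; rewrite /tri3 /=; split=> //.
  + rewrite disjoint_sym; apply: disjointU1r; first by rewrite !inE negb_or t1t2 (sep_notin st12) ?set11.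
    by apply: sep_disjoint; apply: sK1'.
  + by exists l2; rewrite // inE l2K orbT.
  + by exists t1; rewrite ?setU11 // nbrU nbr1 t12.
  + by rewrite sub1set (subsetP K1D).
  + exact: conn1.
  + by apply: disjoint1r; rewrite !inE negb_or eq_sym t1l1 l1A.
  + by exists l1; rewrite ?set11.
  + have /nbrP[u uU lu] := leaf_touch cK1 K1D l1K l1A cK1c cA.
    by exists u; rewrite ?nbr1 1?edgeC // inE uU orbT.
  + by rewrite subUset sub1set z'D.
  + exact: conn_add.
  + apply: disjointU1r; last exact: sep_disjoint.
    by rewrite !inE negb_or z't1 /= negb_and z'K1 orbT.
  + by exists l0; rewrite // inE l0U orbT.
  + have /nbrP[u uU zu] := nz'K1'; exists u; first by rewrite inE uU orbT.
    by rewrite nbrU nbr1 edgeC zu.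
- apply: ord3_pairs; rewrite /tri3 /=; first by move=> i j; rewrite sepC.
  + exact: s_l1K.
  + by rewrite sepUr szt2U andbT sepUl st2z' sepC.
  + rewrite sepUr; apply/andP; split; last by rewrite sepC; apply: s_l1K.
    by rewrite sepC; apply: (leaf_priv (X := K1) (c := c)).
move=> d F [FP de Fo].
have [cG0 dG0 sG0 [p0 p0F p0A]] := FP o0.
have [cG1 dG1 sG1 [p1 p1F p1A]] := FP o1.
have [cG2 dG2 sG2 [p2 p2F p2A]] := FP o2.
rewrite /tri3 /= in sG0 sG1 sG2.
have BA p : p \in A -> p \notin t1 |: (K1 :\: A).
  by move=> pA; rewrite !inE negb_or pA andbT; apply: contraTneq pA => ->.
(* In [t2 |: K2] this corner could see only [t1] in the other two sets, so the other two corners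
   would coincide. *)
have in_F0 : d o0 \in t1 |: (K1 :\: A).
  move: (subsetP sG0 _ dG0) => /setUP[dK|//].
  have nb v : edge (d o0) v -> v \in [set l1] :|: (z' |: U) :|: (t1 |: (K1 :\: A)) -> v = t1.
    move=> dv; rewrite -!setUA => v_in; apply/eqP; apply: contraLR dv => vt1.
    have : v \in K1 :|: (z' |: U).
      move: v_in; rewrite !inE (negPf vt1) /=.
      by case/or4P=> [/eqP->|->|->|/andP[_ ->]]; rewrite ?l1K ?orbT.
    by apply: sep_edge dK; rewrite !sepUr st2K szt2U andbT sepUl st2z' sepC.
  have e1 : d o1 = t1.
    apply: nb (de o0 o1 isT) _; apply: (subsetP _ _ (subsetP sG1 _ dG1)).
    by rewrite setSU // subsetUl.
  have e2 : d o2 = t1.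
    apply: nb (de o0 o2 isT) _; apply: (subsetP _ _ (subsetP sG2 _ dG2)).
    by rewrite setSU // subsetUr.
  by have [] := Fo o1 o2 isT _ _ dG1 dG2; rewrite e1 e2 eqxx.
have in_F2 : d o2 \in z' |: (t1 |: (K1 :\: A)).
  move: (subsetP sG2 _ dG2); rewrite -setUA (setUC U) setUA => /setUP[//|dU].
  by case/negP: (sep_edge sBU in_F0 dU); apply: de.
have [J1 [cJ1 dJ1 t1J1 subJ1]] : exists C : {set G},
    [/\ conn C, d o0 \in C, t1 \in C & C \subset F o0 :&: (t1 |: (K1 :\: A))].
  apply: (reach cG0 dG0 in_F0 p0F (BA _ p0A)) => u v uX vF vX uv.
  move: (subsetP sG0 _ vF); rewrite inE (negPf vX) orbF => vK.
  move: uX; rewrite in_setU1 => /predU1P[//|uK].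
  by case/negP: (sep_edge st2K vK (subsetP K1'K1 _ uK)); rewrite edgeC.
have [J3 [cJ3 dJ3 z'J3 subJ3]] : exists C : {set G},
    [/\ conn C, d o2 \in C, z' \in C & C \subset F o2 :&: (z' |: (t1 |: (K1 :\: A)))].
  apply: (reach cG2 dG2 in_F2 p2F).
    by rewrite in_setU1 negb_or BA // andbT; apply: contraTneq p2A => ->.
  move=> u v uX vF vX uv.
  move: (subsetP sG2 _ vF); rewrite -setUA (setUC U) setUA inE (negPf vX) /= => vU.
  move: uX; rewrite in_setU1 => /predU1P[//|uB].
  by case/negP: (sep_edge sBU uB vU).
move: subJ1 subJ3; rewrite !subsetI => /andP[J1F J1X] /andP[J3F J3X].
have t1F0 : t1 \in F o0 := subsetP J1F _ t1J1.
have t1F i : i != o0 -> t1 \notin F i.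
  by move=> i0; apply/negP=> t1F; have [/eqP] := Fo i o0 i0 _ _ t1F t1F0.
have subF1 : F o1 \subset K1.
  apply/subsetP=> x xF; have xt1 : x != t1 by apply: contraTneq xF => ->; apply: t1F.
  move: (subsetP sG1 _ xF); rewrite !inE (negPf xt1) /=.
  by case/orP=> [/eqP->//|/andP[]].
have l1F1 : l1 \in F o1.
  by move: (subsetP sG1 _ p1F); rewrite inE (negPf (BA _ p1A)) orbF => /set1P <-.
have subJ3 : J3 \subset z' |: (K1 :\: A).
  apply/subsetP=> x xJ; move: (subsetP J3X _ xJ); rewrite !in_setU1.
  case/or3P=> [->//|/eqP xt1|->]; last by rewrite orbT.
  by have := t1F o2 isT; rewrite -xt1 (subsetP J3F).
have ca1 : conn (a |: F o1) by apply: conn_add => //; apply: nbr_intro l1F1 _; apply: al.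
have saJ3 : sep [set a] J3 by apply: (sepS (subxx _) subJ3); rewrite sepUr saz'.
have saC2 : sep [set a] C2 by apply: (sepS (subxx _) C2X); rewrite sepUr saz'.
have szK1' : sep [set z] (K1 :\: A) := sK1' _ sz1.
have szJ3 : sep [set z] J3.
  by apply: (sepS (subxx _) subJ3); rewrite sepUr szK1' andbT sepC.
have sF1U : sep (F o1) U := sepS subF1 (subxx _) sK1U.
(* The analogous prism at the other end: if [t1] is not a corner, the second triangle is disjoint
   from [t1], [t2], [z], and [t2] is reached from a leaf of [K1] through [a] and [K2]. *)
have [d0_t1|d0_t1] := eqVneq (d o0) t1; last first.
  apply: (@no_prism3 _ tpf (d o0) (d o1) (d o2) t1 t2 z
    J1 ((a |: F o1) :|: (t2 |: K2)) (z |: (J3 :|: (U :\: A)))).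
  - split=> //.
    + apply: contraTneq (subsetP subF1 _ dG1) => ->.
      by rewrite (sep_notin st21) ?set11.
    + apply: contraTneq (subsetP subJ3 _ dJ3) => ->.
      by rewrite (sep_notin (Y := z' |: (K1 :\: A)) (X := [set z])) ?set11 // sepUr szK1' andbT sepC.
  - by split; apply: de.
  - by split; rewrite // edgeC.
  - split=> //.
      apply: (connU (x := a) (y := l2)); rewrite ?al ?orbT ?setU11 //.
      by rewrite !inE l2K orbT.
    apply: conn_add; last by rewrite nbrU nzU' orbT.
    have /nbrP[k kU zk] := nz'U'.
    by apply: (connU (x := z') (y := k)); rewrite ?zk ?orbT.
  - by split; rewrite // !inE ?dG1 ?dJ3 ?orbT.
  - by split; rewrite // !inE ?eqxx ?orbT.
  - apply: onlyUr; apply: onlyUr.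
    + by apply: only_sep; apply: (sepS J1X (subxx _)); rewrite sepC sepUr sat1.
    + by apply: onlyS (Fo o0 o1 _) _ => //; left.
    + apply: (onlyS J1X (subxx _) (R := two (d o0) (d o1) t1 t2)) => //; apply: onlyUl.
        by apply: only1 => // _; right.
      by apply: only_sep; rewrite sepC; apply: sK1'.
    + by apply: only_sep; apply: (sepS J1X (subxx _)); rewrite sepUl st12; apply: sepS sK12.
  - apply: onlyUr; last apply: onlyUr.
    + apply: (onlyS J1X (subxx _) (R := two (d o0) (d o2) t1 z)) => //; apply: onlyUl.
        by apply: only1 => // ?; right.
      by apply: only_sep; rewrite sepC.
    + by apply: onlyS (Fo o0 o2 _) _ => //; left.
    + by apply: only_sep; apply: (sepS J1X (subxx _)); apply: sU'.
  - apply: onlyUl; apply: onlyUl.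
    + by apply: only_sep; rewrite !sepUr saz saJ3.
    + apply: onlyUr; last apply: onlyUr.
      * by apply: only_sep; rewrite sepC; apply: sepS sz1.
      * by apply: onlyS (Fo o1 o2 _) _ => //; left.
      * by apply: only_sep; apply: sU'.
    + apply: onlyUr; last apply: onlyUr.
      * by apply: only1 => [|_]; [rewrite eq_sym | right].
      * by apply: only_sep; apply: (sepS (subxx _) subJ3); rewrite sepUr st2z' sK1'.
      * by apply: only_sep; apply: sU'.
    + apply: onlyUr; last apply: onlyUr; apply: only_sep.
      * by rewrite sepC.
      * by rewrite sepC; apply: (sepS subJ3 (subxx _)); rewrite sepUl sz'2; apply: sepS sK12.
      * exact: sU'.
have z'F2 : z' \in F o2 := subsetP J3F _ z'J3.
have zF0' : z \in F' o0 := subsetP C1F _ zC1.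
have z'F1' : z' \in F' o1 := subsetP C2F _ z'C2.
have ed' i j : i != j -> edge (d' i) (d' j) by apply: d'e.
(* Now each of the two new triangles has an end of the edge between [t1] and [z] as a corner. They
   are joined by that edge, by a path through [a] between leaves of [K1] and [U], and by a path
   through [z']. *)
apply: (@no_prism3 _ tpf t1 (d o1) (d o2) z (d' o2) (d' o1)
    ([set t1] :|: [set z]) ((a |: F o1) :|: F' o2) (J3 :|: C2)).
- split=> //.
  + apply: contraTneq (subsetP subF1 _ dG1) => ->.
    by rewrite (sep_notin sUK1) // (subsetP subF2).
  + apply: contraTneq (subsetP subJ3 _ dJ3) => ->.
    have d1z' : d' o1 != z'.
      by apply: contraTneq d1U => ->; rewrite inE (negPf z'U) andbF.
    rewrite in_setU1 (negPf d1z') /= (sep_notin _ d1U) //; exact: sepS sUK1.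
- by rewrite -d0_t1; split; apply: de.
- by rewrite -z_d0; split; apply: ed'.
- split.
  + by apply: (connU (conn1 t1) (conn1 z) (set11 _) (set11 _)); rewrite edgeC zt1 orbT.
  + by apply: (connU (x := a) (y := l0)); rewrite ?al ?orbT ?setU11.
  + by apply: (connU (x := z') (y := z')); rewrite ?eqxx.
- by split; rewrite !inE ?eqxx ?dG1 ?dJ3 ?orbT.
- by split; rewrite !inE ?eqxx ?dF2 ?dC2 ?orbT.
- apply: onlyUl; apply: onlyUr; try apply: onlyUr.
  + by apply: only_sep; rewrite sepC.
  + by apply: onlyS (Fo o0 o1 _) _ => //; rewrite ?sub1set // d0_t1; left.
  + by apply: only_sep; apply: sepS st1U.
  + by apply: only_sep; rewrite sepC.
  + by apply: only_sep; apply: sepS sz1.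
  + by apply: onlyS (F'o o0 o2 _) _ => //; rewrite ?sub1set // z_d0; right.
- apply: onlyUl; apply: onlyUr.
  + by apply: onlyS (Fo o0 o2 _) _ => //; rewrite ?sub1set // d0_t1; left.
  + apply: (onlyS (subxx _) C2X (R := two t1 (d o2) z (d' o1))) => //; apply: onlyUr.
      by apply: onlyS (Fo o0 o2 _) _ => //; rewrite ?sub1set // d0_t1; left.
    by apply: only_sep; apply: sU'.
  + exact: only_sep.
  + by apply: onlyS (F'o o0 o1 _) _ => //; rewrite ?sub1set // z_d0; right.
- apply: onlyUl; first apply: onlyUl; apply: onlyUr.
  + exact: only_sep.
  + exact: only_sep.
  + by apply: onlyS (Fo o1 o2 _) _ => //; left.
  + apply: (onlyS (subxx _) C2X (R := two (d o1) (d o2) (d' o2) (d' o1))) => //; apply: onlyUr.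
      by apply: onlyS (Fo o1 o2 _) _ => //; rewrite ?sub1set //; left.
    by apply: only_sep; apply: sU'.
  + apply: (onlyS (subxx _) subJ3 (R := two (d o1) (d o2) (d' o2) (d' o1))) => //; apply: onlyUr.
      by apply: onlyS (F'o o2 o1 _) _ => //; rewrite ?sub1set //; right.
    by apply: only_sep; apply: sepS sUK1.
  + by apply: onlyS (F'o o2 o1 _) _ => //; right.
Qed.

(** * Separating many leaves from [b] *)

Variables (t : nat) (b : G) (link : G -> seq G).
Hypothesis no_clique : ~ (exists K : {set G}, clique K /\ #|K| = t).
Hypothesis t_gt1 : 1 < t.
Hypothesis bD : b \in D.
Hypothesis bA : b \notin A.
Hypothesis linkP : {in A, forall l, [/\ path (@edge G) l (link l), last l (link l) = b
   & {subset link l <= D}]}.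
Hypothesis link_disj : {in A &, forall l l', l != l' ->
   forall x, x \in l :: link l -> x \in l' :: link l' -> x = b}.

Variable M : nat.
Hypothesis M_gt1 : 1 < M.
Hypothesis ramseyM : forall (T : eqType) (c : T -> T -> bool) (s : seq T),
  M <= size s -> exists i s',
    [/\ subseq s' s, size s' = t.+1 & pairwise (fun u v => c u v == i) s'].

Lemma leaf_edge X l c x : conn X -> X \subset D -> l \in X -> l \in A ->
  c \in X -> l != c -> x \in D -> x \notin X -> ~~ edge x l.
Proof.
move=> cX XD lX lA cX' lc xD xX.
by have := leaf_priv cX XD lX lA cX' lc xD xX; rewrite sep11 => /andP[].
Qed.

(** Maximality of [U] takes the form of an induction on the number of vertices of [D] outside it: a
    pair with a larger first set is refuted by the induction hypothesis. *)
Lemma no_separated_leaves (U S0 : {set G}) : leg U -> b \in U -> S0 \subset D -> conn S0 ->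
  sep U S0 -> M <= #|S0 :&: A| -> False.
Proof.
have [n] := ubnP #|D :\: U|; elim: n U S0 => // n IH U S0 lt_n.
move=> legU bU S0D cS0 sUS0 leM0.
have [UD cU [l0 l0U l0A]] := legP _ legU.
have /card_gt0P[al0 /setIP[al0S0 al0A]] : 0 < #|S0 :&: A| by apply: leq_trans leM0; apply: ltnW.
pose V := [set x in D | (x \notin U) && ~~ nbr x U].
have S0V : S0 \subset V.
  apply/subsetP=> x xS0; rewrite inE (subsetP S0D) //.
  have sx : sep [set x] U by rewrite sepC; apply: sepS sUS0; rewrite ?sub1set.
  by move: sx; rewrite sep1.
have al0V := subsetP S0V _ al0S0.
(* Passing from [S0] to the whole component ensures that every vertex of [D] through which [S] is
   left has a neighbor in [U]. *)
pose S := component V al0.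
have SV : S \subset V := component_sub al0V.
have cS : conn S := conn_component al0V.
have SD : S \subset D by apply: subset_trans SV _; apply/subsetP=> x /[!inE] /andP[].
have sUS : sep U S.
  rewrite sepC; apply/sepP=> x y /(subsetP SV); rewrite inE => /and3P[_ xU nxU] yU.
  by split; [apply: contraNneq xU => -> | apply: contra nxU; apply: nbr_intro].
have leM : M <= #|S :&: A|.
  by apply: leq_trans leM0 (subset_leq_card _); apply: setSI; apply: sub_component.
have bS : b \notin S by apply: sep_notin sUS bU.
pose inC y := [/\ y \in D, y \notin U, y \notin S, nbr y U & nbr y S].
have Sout x y : x \in S -> y \in D -> edge x y -> y \notin S -> inC y.
  move=> xS yD xy yS.
  have := subsetP SV _ xS; rewrite inE => /and3P[_ xU nxU].
  have yU : y \notin U by apply: contra nxU => yU; apply: nbr_intro xy.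
  split=> //; last by apply: nbr_intro xS _; rewrite edgeC.
  apply: contraNT yS => nyU; apply: component_closed xy => //.
  by rewrite inE yD yU.
have leafS l : l \in S :&: A -> exists2 c, c \in S & l != c.
  case/setIP=> lS lA; have : 0 < #|(S :&: A) :\ l|.
    by move: (leq_trans M_gt1 leM); rewrite (cardsD1 l) inE lS lA add1n ltnS.
  by case/card_gt0P=> c /setD1P[cl /setIP[cS' _]]; exists c; rewrite // eq_sym.
have C_leaf z l : inC z -> l \in S :&: A -> ~~ edge z l.
  case=> zD _ zS _ _ lSA; have [c cS' lc] := leafS _ lSA; case/setIP: lSA => lS lA.
  exact: (leaf_edge cS SD lS lA cS' lc).
(* [o l] is the vertex at which the link from l leaves S. *)
have exitE l : exists p : G * (seq G), l \in S :&: A ->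
    [/\ inC p.1, p.1 \in link l, {subset p.2 <= S},
        {subset p.2 <= link l} /\ path (@edge G) l p.2 & edge p.1 (last l p.2)].
  have [lSA|lSA] := boolP (l \in S :&: A); last by exists (b, [::]).
  case/setIP: (lSA) => lS lA; have [pl ll Dl] := linkP lA.
  have [|q1 [v [q2 [def_q sub1 vS ev]]]] := walk_exit pl lS; first by rewrite ll.
  have v_link : v \in link l by rewrite def_q mem_cat mem_head orbT.
  exists (v, q1) => _; split=> //=.
  - by apply: Sout ev _ => //; [apply: sub1; apply: mem_last | apply: Dl].
  - by move=> x xq; apply: sub1; rewrite inE xq orbT.
  - split; first by move=> x xq; rewrite def_q mem_cat xq.
    by move: pl; rewrite def_q cat_path => /andP[].
  - by rewrite edgeC.
have [ex exP] := fin_all_exists exitE.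
pose o l := (ex l).1.
(* Two links meet only in [b], which lies in [U], while an exit vertex does not. *)
have o_inj : {in S :&: A &, injective o}.
  move=> l l' lSA lSA' eq_o; apply/eqP; case: (eqVneq l l') => // ll'.
  have [[_ oU _ _ _] ol _ _ _] := exP l lSA; have [_ ol' _ _ _] := exP l' lSA'.
  case/setIP: lSA => _ lA; case/setIP: lSA' => _ lA'.
  have eq_b : o l = b.
    by apply: (link_disj lA lA' ll'); rewrite inE ?ol ?orbT // eq_o ol' orbT.
  by rewrite -/(o l) eq_b bU in oU.
pose S_ z := [set x in S | ~~ edge z x].
pose K z l := component (S_ z) l.
have inS_ z l : inC z -> l \in S :&: A -> l \in S_ z.
  by move=> zC lSA; rewrite inE (C_leaf z) // andbT; case/setIP: lSA.
(* Otherwise [z |: U] and this component would be a pair with a larger first set. *)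
have small z l : inC z -> l \in S :&: A -> #|K z l :&: A| < M.
  move=> zC lSA; have [zD zU zS nzU nzS] := zC; rewrite ltnNge; apply/negP=> leK.
  have KS_ : K z l \subset S_ z := component_sub (inS_ z l zC lSA).
  have KS : K z l \subset S by apply: subset_trans KS_ _; apply/subsetP=> x /[!inE] /andP[].
  apply: (IH (z |: U) (K z l)) => //.
  - apply: leq_trans (_ : #|D :\: U| <= n); last by rewrite -ltnS.
    apply: proper_card; apply/properP; split; first by apply: setDS; apply: subsetUr.
    by exists z; rewrite !inE ?eqxx // zU zD.
  - apply/legP; split; [by rewrite subUset sub1set zD | exact: conn_add|].
    by exists l0; rewrite // inE l0U orbT.
  - by rewrite inE bU orbT.
  - exact: subset_trans SD.
  - exact: conn_component (inS_ z l zC lSA).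
  - rewrite sepUl (sepS (subxx _) KS sUS) andbT sep1; apply/andP; split.
      by apply: contra zS; apply: (subsetP KS).
    apply/nbrP=> -[x /(subsetP KS_)]; rewrite inE => /andP[_ /negP]; exact.
(* Of the [t.+1] exits, one becomes [z] and the links of the other [t] provide [t] attachments. As
   [1 < t], there are at least 3 exits, enough for [K_{2,3}]. *)
have [i [s [sub_s size_s pw_s]]] := ramseyM (fun l l' => edge (o l) (o l')) (s := enum (S :&: A)) ltac:(by rewrite -cardE).
have s_SA l : l \in s -> l \in S :&: A by move=> /(mem_subseq sub_s); rewrite mem_enum.
have uq_s : uniq s := subseq_uniq sub_s (enum_uniq _).
case: i pw_s => pw_s.
  apply: (no_clique_seq no_clique (s := map o s)); first by rewrite size_map size_s.
  by rewrite pairwise_map; apply: sub_pairwise pw_s => l l' /eqP.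
have pw_o : pairwise (fun x y => ~~ edge x y) (map o s).
  by rewrite pairwise_map; apply: sub_pairwise pw_s => l l' /eqP /= ->.
have uq_o : uniq (map o s).
  by rewrite map_inj_in_uniq // => l l' ls ls'; apply: o_inj; apply: s_SA.
case: s size_s s_SA uq_s pw_o uq_o {sub_s pw_s} => // h ss [size_ss] s_SA uq_s pw_o uq_o.
pose z := o h.
have hSA : h \in S :&: A by apply: s_SA; apply: mem_head.
have zC : inC z by have [] := exP h hSA.
have [zD zU zS nzU nzS] := zC.
have KP l : l \in S :&: A -> [/\ leg (K z l), K z l \subset S, sep U (K z l),
    sep [set z] (K z l) & l \in K z l].
  move=> lSA; have lS_ := inS_ z l zC lSA.
  have KS_ : K z l \subset S_ z := component_sub lS_.
  have KS : K z l \subset S by apply: subset_trans KS_ _; apply/subsetP=> x /[!inE] /andP[].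
  have lK : l \in K z l := component_refl _ _.
  split=> //; last 2 first.
  - exact: sepS sUS.
  - rewrite sep1; apply/andP; split; first by apply: contra zS; apply: (subsetP KS).
    by apply/nbrP=> -[x /(subsetP KS_)]; rewrite inE => /andP[_ /negP].
  apply/legP; split; [exact: subset_trans SD | exact: conn_component|].
  by exists l => //; case/setIP: lSA.
have KC l x y : l \in S :&: A -> x \in K z l -> y \in S -> edge x y -> y \notin K z l -> edge z y.
  move=> lSA xK yS xy; apply: contraNT => zy; apply: component_closed xy => //; first exact: inS_.
  by rewrite inE yS.
pose T := [set x in S | edge z x].
have TK l x : l \in S :&: A -> x \in T -> x \notin K z l.
  move=> lSA; rewrite {1}inE => /andP[_ zx]; apply/negP=> /(subsetP (component_sub (inS_ z l zC lSA))).
  by rewrite inE zx andbF.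
have Kexit l : l \in S :&: A -> exists2 x, x \in T & nbr x (K z l).
  move=> lSA; have [_ KS _ _ lK] := KP l lSA.
  have [x xS zx] := nbrP _ _ nzS.
  have xK : x \notin K z l by apply: TK; rewrite // inE xS.
  have [u [v [uS uK vS vK uv]]] := conn_exit cS (subsetP KS _ lK) lK xS xK.
  by exists v; [rewrite inE vS (KC l u) | apply: nbr_intro uK _; rewrite edgeC].
have Kdiff l : l \in S :&: A -> exists2 l', l' \in S :&: A & l' \notin K z l.
  move=> lSA; have /subsetPn[l' l'SA l'K] : ~~ (S :&: A \subset K z l :&: A).
    apply/negP=> /subset_leq_card le; have := small z l zC lSA.
    by rewrite ltnNge (leq_trans leM).
  by exists l' => //; apply: contra l'K => l'K; rewrite inE l'K; case/setIP: l'SA.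
have Ksep l l' : l \in S :&: A -> l' \in S :&: A -> l' \notin K z l -> sep (K z l) (K z l').
  by move=> lSA lSA'; apply: component_sep; apply: inS_.
have Kdiff_sym l l' : l \in S :&: A -> l' \in S :&: A -> l' \notin K z l -> l \notin K z l'.
  by move=> lSA lSA' /(Ksep l l' lSA lSA') s; have [_ _ _ _ lK] := KP l lSA; apply: sep_notin s lK.
have legz : leg (z |: U).
  apply/legP; split; [by rewrite subUset sub1set zD | exact: conn_add|].
  by exists l0; rewrite // inE l0U orbT.
have Tsep x : x \in T -> [/\ x \in D, x \in S, edge z x, x \notin U & sep [set x] U].
  rewrite inE => /andP[xS zx]; have sx : sep [set x] U.
    by rewrite sepC; apply: sepS sUS; rewrite ?sub1set.
  by split=> //; [apply: (subsetP SD) | apply: sep_notin sx (set11 _)].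
(* Otherwise [x] is the center of a theta whose third leg returns through [z] to [U]. *)
have attach_one x l l' : x \in T -> l \in S :&: A -> l' \in S :&: A -> l' \notin K z l ->
    nbr x (K z l) -> ~~ nbr x (K z l').
  move=> xT lSA lSA' ll' nl; apply/negP=> nl'.
  have [xD xS zx xU sxU] := Tsep x xT.
  have [legl _ sUl szl _] := KP l lSA; have [legl' _ sUl' szl' _] := KP l' lSA'.
  apply: (@no_claw3 x (z |: U) (K z l) (K z l')) => //; try exact: TK.
  - by rewrite !inE negb_or xU andbT; apply: contraTneq zx => ->; rewrite edge_irrefl.
  - by apply: nbr_intro (setU11 _ _) _; rewrite edgeC.
  - by rewrite sepUl szl.
  - by rewrite sepUl szl'.
  - exact: Ksep.
have sepTK x l l' : x \in T -> l \in S :&: A -> l' \in S :&: A -> l' \notin K z l ->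
    nbr x (K z l) -> sep [set x] (K z l').
  by move=> xT lSA lSA' ll' nl; rewrite sep1 TK // (attach_one x l).
have legTK x l : x \in T -> l \in S :&: A -> nbr x (K z l) -> leg (x |: K z l).
  move=> xT lSA nl; have [xD _ _ _ _] := Tsep x xT; have [legl _ _ _ lK] := KP l lSA.
  have [KD cK _] := legP _ legl.
  apply/legP; split; [by rewrite subUset sub1set xD | exact: conn_add|].
  by exists l; [rewrite inE lK orbT | case/setIP: lSA].
(* Otherwise [z] is the center of a theta with legs [U] and the two components extended by [x] and
   [x']. *)
have attach_complete x x' l l' : x \in T -> x' \in T -> l \in S :&: A -> l' \in S :&: A -> l' \notin K z l ->
    nbr x (K z l) -> nbr x' (K z l') -> edge x x'.
  move=> xT xT' lSA lSA' ll' nl nl'; apply: contraT => xx'; exfalso.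
  have [xD xS zx xU sxU] := Tsep x xT; have [xD' xS' zx' xU' sxU'] := Tsep x' xT'.
  have [legl KS sUl szl _] := KP l lSA; have [legl' KS' sUl' szl' _] := KP l' lSA'.
  have zz v : edge z v -> z != v by apply: contraTneq => <-; rewrite edge_irrefl.
  apply: (@no_claw3 z U (x |: K z l) (x' |: K z l')) => //; try exact: legTK.
  - by rewrite in_setU1 negb_or zz // (sep_notin szl) ?set11.
  - by rewrite in_setU1 negb_or zz // (sep_notin szl') ?set11.
  - by rewrite nbrU nbr1 zx.
  - by rewrite nbrU nbr1 zx'.
  - by rewrite sepUr sUl andbT sepC.
  - by rewrite sepUr sUl' andbT sepC.
  - rewrite sepUl !sepUr Ksep // sep11 xx' (sepTK x l) //= !andbT; apply/andP; split.
      by apply: contraNneq (attach_one x l l' xT lSA lSA' ll' nl) => ->.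
    by rewrite sepC (sepTK x' l') //; apply: Kdiff_sym.
(* If [z'] had a neighbor in [K z l], thetas centered at [z'] would forbid it neighbors in a second
   component [K z l'] and adjacency to the attachment [x2] of that component. This is the situation
   excluded by [no_detour]. *)
have far_from_K z' l : inC z' -> z' != z -> ~~ edge z z' -> l \in S :&: A -> ~~ nbr z' (K z l).
  move=> zC' z'z zz' lSA; apply/negP=> nl.
  have [zD' zU' zS' nzU' nzS'] := zC'.
  have [legl KS sUl szl _] := KP l lSA.
  have [l' lSA' ll'] := Kdiff l lSA.
  have [legl' KS' sUl' szl' _] := KP l' lSA'.
  have ll := Kdiff_sym _ _ lSA lSA' ll'.
  have [x1 xT1 n1] := Kexit l lSA; have [x2 xT2 n2] := Kexit l' lSA'.
  have [xD1 xS1 zx1 xU1 sxU1] := Tsep x1 xT1; have [xD2 xS2 zx2 xU2 sxU2] := Tsep x2 xT2.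
  have z'x v : v \in S -> z' != v by move=> vS; apply: contraNneq zS' => ->.
  have z'K m : m \in S :&: A -> z' \notin K z m.
    by move=> mSA; have [_ KSm _ _ _] := KP m mSA; apply: contra zS'; apply: (subsetP KSm).
  have nl' : ~~ nbr z' (K z l').
    apply/negP=> nl'.
    by apply: (@no_claw3 z' U (K z l) (K z l')) => //; [exact: z'K | exact: z'K | exact: Ksep].
  have zx2' : ~~ edge z' x2.
    apply/negP=> zx2'; apply: (@no_claw3 z' U (K z l) (x2 |: K z l')) => //; try exact: legTK.
    - exact: z'K.
    - by rewrite in_setU1 negb_or z'x // z'K.
    - by rewrite nbrU nbr1 zx2'.
    - by rewrite sepUr sUl' andbT sepC.
    - by rewrite sepUr Ksep // andbT sepC; apply: (sepTK x2 l').
  apply: (@no_detour U (K z l) (K z l') z z' x1 x2 b) => //; try exact: Ksep.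
  - exact: z'K.
  - by rewrite sep1 z'K.
  - by rewrite sep11 z'z edgeC.
  - by rewrite sep11 z'x.
  - exact: z'x.
  - exact: TK.
  - exact: (sepTK x1 l).
  - exact: TK.
  - exact: (sepTK x2 l').
  - exact: (attach_complete x1 x2 l l').
have attach_other z' x l : inC z' -> z' != z -> ~~ edge z z' -> l \in S :&: A ->
    x \in T -> nbr x (K z l) -> edge z' x.
  move=> zC' z'z zz' lSA xT nl.
  have [zD' zU' zS' nzU' nzS'] := zC'.
  have far' m : m \in S :&: A -> ~~ nbr z' (K z m) by apply: far_from_K.
  have legz' : leg (z' |: U).
    apply/legP; split; [by rewrite subUset sub1set zD' | exact: conn_add|].
    by exists l0; rewrite // inE l0U orbT.
  have sz'K m : m \in S :&: A -> sep [set z'] (K z m).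
    move=> mSA; rewrite sep1 far' // andbT; have [_ KSm _ _ _] := KP m mSA.
    by apply: contra zS'; apply: (subsetP KSm).
  (* If [z'] saw [x1] but not [x2], then [x1] would be the center of a theta with legs [z' |: U],
     [K z l1] and [x2 |: K z l2]. *)
  have step x1 x2 l1 l2 : x1 \in T -> x2 \in T -> l1 \in S :&: A -> l2 \in S :&: A ->
      l2 \notin K z l1 -> nbr x1 (K z l1) -> nbr x2 (K z l2) -> edge z' x1 -> edge z' x2.
    move=> xT1 xT2 lS1 lS2 l12 n1 n2 zx1; apply: contraT => zx2; exfalso.
    have [xD1 xS1 _ xU1 sxU1] := Tsep x1 xT1; have [xD2 xS2 _ xU2 sxU2] := Tsep x2 xT2.
    have [leg1 KS1 sU1 _ _] := KP l1 lS1; have [leg2 KS2 sU2 _ _] := KP l2 lS2.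
    have x12 : edge x1 x2 by apply: (attach_complete x1 x2 l1 l2).
    have s12 := sepTK x1 l1 l2 xT1 lS1 lS2 l12 n1.
    apply: (@no_claw3 x1 (z' |: U) (K z l1) (x2 |: K z l2)) => //.
    - exact: legTK.
    - by rewrite !inE negb_or xU1 andbT; apply: contraNneq zS' => <-.
    - exact: TK.
    - rewrite in_setU1 negb_or TK // andbT.
      by apply: contraTneq x12 => ->; rewrite edge_irrefl.
    - by apply: nbr_intro (setU11 _ _) _; rewrite edgeC.
    - by rewrite nbrU nbr1 x12.
    - by rewrite sepUl sz'K.
    - rewrite sepUl !sepUr sz'K // sU2 sep11 zx2 /= !andbT [sep U _]sepC sxU2 andbT.
      by apply: contraNneq zS' => ->.
    - rewrite sepUr Ksep // andbT sepC (sepTK x2 l2) //; exact: Kdiff_sym.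
  have [l' lSA' ll'] := Kdiff l lSA; have ll := Kdiff_sym _ _ lSA lSA' ll'.
  have [x' xT' n'] := Kexit l' lSA'.
  (* Attachments of the same component are compared through an attachment of another one, so [z']
     sees all attachments or none. *)
  have some_suff x1 l1 : x1 \in T -> l1 \in S :&: A -> nbr x1 (K z l1) -> edge z' x1 -> edge z' x.
    move=> xT1 lS1 n1 zx1; have [l1K|l1K] := boolP (l1 \in K z l).
      have eqK : ~~ (l' \in K z l1).
        have [_ _ _ _ l1K1] := KP l1 lS1.
        apply: contra ll' => l'K1; rewrite inE; rewrite !inE in l1K l'K1.
        exact: connect_trans l'K1.
      have zx' := step x1 x' l1 l' xT1 xT' lS1 lSA' eqK n1 n' zx1.
      exact: (step x' x l' l).
    by apply: (step x1 x l1 l) => //; apply: Kdiff_sym.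
  (* If [z'] sees none, all components and their attachments avoid its neighborhood. Attachments of
     different components are adjacent and glue the components together, so one component of [S_ z']
     contains every leaf of [S], contrary to [small]. *)
  apply: contraT => zx; exfalso.
  have none x1 l1 : x1 \in T -> l1 \in S :&: A -> nbr x1 (K z l1) -> x1 \in S_ z'.
    move=> xT1 lS1 n1; have [_ xS1 _ _ _] := Tsep x1 xT1; rewrite inE xS1.
    by apply: contra zx; apply: some_suff n1.
  have KS_ m : m \in S :&: A -> K z m \subset S_ z'.
    move=> mSA; have [_ KSm _ _ _] := KP m mSA; apply/subsetP=> v vK.
    by rewrite inE (subsetP KSm) //=; apply: (sep_edge (sz'K m mSA) (set11 _) vK).
  have cK m : m \in S :&: A -> conn (K z m) by move=> mSA; have [/legP[]] := KP m mSA.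
  have := small z' l zC' lSA; rewrite ltnNge (leq_trans leM) //.
  apply: subset_leq_card; apply/subsetP=> m mSA; rewrite inE.
  case/setIP: (mSA) => mS mA; rewrite mA andbT.
  have [_ _ _ _ mKm] := KP m mSA; have [_ _ _ _ lKl] := KP l lSA.
  have [mK|mK] := boolP (m \in K z l).
    by apply: (subsetP (sub_component (cK l lSA) (KS_ l lSA) lKl)).
  have [xm xTm nm] := Kexit m mSA.
  have xmx : edge x xm by apply: (attach_complete x xm l m).
  have cW : conn ((x |: K z l) :|: (xm |: K z m)).
    apply: (connU (x := x) (y := xm)); rewrite ?setU11 ?xmx ?orbT //.
      by apply: conn_add => //; apply: cK.
    by apply: conn_add => //; apply: cK.
  apply: (subsetP (sub_component (X := S_ z') cW _ _)).
  - by rewrite !subUset !sub1set !KS_ // (none x l) // (none xm m).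
  - by rewrite in_setU in_setU1 lKl orbT.
  - by rewrite in_setU !in_setU1 mKm !orbT.
have other l : l \in ss -> [/\ l \in S :&: A, inC (o l), o l != z & ~~ edge z (o l)].
  move=> lss; have lSA : l \in S :&: A by apply: s_SA; rewrite inE lss orbT.
  split=> //; first by have [] := exP l lSA.
    by move: uq_o => /= /andP[/memPn neq _]; apply: neq; apply: map_f.
  by move: pw_o => /= /andP[/allP nz _]; apply: nz; apply: map_f.
(* The link of [l] starts in [K z l], but the last vertex before its exit [o l] lies outside,
   because [o l] has no neighbor in [K z l]. So the link leaves this component inside [S], at an
   attachment. *)
have crossE l : exists x, l \in ss -> [/\ x \in link l, x \in T & nbr x (K z l)].
  have [lss|] := boolP (l \in ss); last by exists b.
  have [lSA olC olz zol] := other l lss.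
  have [_ ol qS [q_link pq] e_q] := exP l lSA.
  have [_ KS _ _ lK] := KP l lSA.
  have [|q1 [v [q2 [def_q sub1 vK ev]]]] := walk_exit pq lK.
    by apply: contra (far_from_K (o l) l olC olz zol lSA) => lastK; apply: nbr_intro lastK _.
  have vq : v \in (ex l).2 by rewrite def_q mem_cat mem_head orbT.
  exists v => _; split; first exact: q_link.
    rewrite inE qS //=; apply: KC ev vK => //; last exact: qS.
    by apply: sub1; apply: mem_last.
  by apply: nbr_intro (sub1 _ (mem_last _ _)) _; rewrite edgeC.
have [cr crP] := fin_all_exists crossE.
have cr_inj : {in ss &, injective cr}.
  move=> l l' lss lss' eq_cr; apply/eqP; case: (eqVneq l l') => // ll'.
  have [lSA _ _ _] := other l lss; have [lSA' _ _ _] := other l' lss'.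
  have [c1 c2 _] := crP l lss; have [c1' _ _] := crP l' lss'.
  case/setIP: lSA => _ lA; case/setIP: lSA' => _ lA'.
  have eq_b : cr l = b.
    by apply: (link_disj lA lA' ll'); rewrite inE ?c1 ?orbT // eq_cr c1' orbT.
  have [_ bS' _ _ _] := Tsep _ c2.
  by rewrite eq_b (negPf bS) in bS'.
have uq_ss : uniq ss by case/andP: uq_s.
have [|x [y [xK yK xy nxy]]] := @no_clique_set _ _ no_clique [set v in map cr ss].
  rewrite cardsE; have /card_uniqP-> : uniq (map cr ss) by rewrite map_inj_in_uniq.
  by rewrite size_map.
have common v : v \in [set v in map cr ss] -> {in map o (h :: ss), forall u, edge v u}.
  rewrite inE => /mapP[l lss ->] u; have [c1 c2 c3] := crP l lss.
  have [lSA _ _ _] := other l lss; have [_ _ zc _ _] := Tsep _ c2.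
  rewrite map_cons inE => /predU1P[->|/mapP[m mss ->]]; first by rewrite edgeC.
  by have [mSA mC mz zm] := other m mss; rewrite edgeC; apply: attach_other c3.
apply: (no_K23 tpf xy nxy (s := map o (h :: ss))) => //.
  by rewrite size_map /= size_ss.
by move=> u us; rewrite !common.
Qed.

(** * The first separated pair *)

Hypothesis connD : conn D.
Hypothesis b_leaf : {in A, forall l, ~~ edge b l}.
Hypothesis A_gt1 : 1 < #|A|.

(** A stage in growing [Q] from [b]: the latest vertex [z] is the only contact of [Q] with [S],
    where all leaves still are. The last clause keeps every leaf among the non-neighbors of [z]. *)
Definition frontier (Q : {set G}) z (S : {set G}) : Prop :=
  [/\ [/\ Q \subset D, conn Q, b \in Q & z \in Q],
      [/\ S \subset D, conn (z |: S) & A \subset S],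
      [disjoint Q & S], {in Q & S, forall x y, edge x y -> x = z}
    & {in A, forall l, ~~ edge z l}].

Lemma leaf_other X l : A \subset X -> exists2 c, c \in X & l != c.
Proof.
move=> AX; have : 0 < #|A :\ l|.
  by have := A_gt1; rewrite (cardsD1 l A); case: (l \in A) => //= /ltnW.
by case/card_gt0P=> c /setD1P[cl cA]; exists c; rewrite 1?eq_sym // (subsetP AX).
Qed.

(** While one component of the non-neighbors of [z] holds all leaves, it becomes the next [S], and a
    neighbor of [z] in [S] touching it becomes the next [z]. As [Q] grows inside [D], this stops. *)
Lemma frontier_split : exists (Q : {set G}) z (S : {set G}), frontier Q z S /\
  {in A, forall l, ~~ (A \subset component (nonnbrs S z) l)}.
Proof.
suff: forall n (Q : {set G}) z (S : {set G}), #|D :\: Q| < n -> frontier Q z S ->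
    exists (Q : {set G}) z (S : {set G}), frontier Q z S /\
  {in A, forall l, ~~ (A \subset component (nonnbrs S z) l)}.
  move=> /(_ #|D :\: [set b]|.+1 [set b] b (D :\ b)); apply=> //.
  split=> //; first by rewrite sub1set set11 conn1.
  - by rewrite subD1set setD1K //; split=> //; rewrite subsetD1 subAD.
  - by rewrite disjoints1 !inE eqxx.
  - by move=> x y /set1P->.
elim=> // n IH Q z S lt_n fr; have [[QD cQ bQ zQ] [SD cS AS] disQS QS zA] := fr.
have [/forall_inP nol|/forall_inPn[l lA]] :=
  boolP [forall l in A, ~~ (A \subset component (nonnbrs S z) l)]; first by exists Q, z, S.
rewrite negbK; set K := component _ _ => AK.
have lS : l \in nonnbrs S z by rewrite inE (subsetP AS) // zA.
have zS : z \notin S by rewrite (disjointFr disQS zQ).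
have [v [vS zv vK nvK]] := nonnbrs_exit cS zS lS; rewrite -/K in vK nvK.
have KN : K \subset nonnbrs S z := component_sub lS.
have KS : K \subset S := subset_trans KN (nonnbrs_sub S z).
have cK : conn K := conn_component lS.
have KD : K \subset D := subset_trans KS SD.
have vQ : v \notin Q by rewrite (disjointFl disQS vS).
have vD := subsetP SD _ vS.
apply: (IH (v |: Q) v K).
  apply: leq_trans (_ : #|D :\: Q| <= n); last by rewrite -ltnS.
  apply: proper_card; apply/properP; split; first by apply: setDS; apply: subsetUr.
  by exists v; rewrite !inE ?eqxx // vQ vD.
split.
- split; rewrite ?setU11 //; first by rewrite subUset sub1set vD.
    by apply: conn_add => //; apply: nbr_intro zQ _; rewrite edgeC.
  by rewrite inE bQ orbT.
- by split=> //; apply: conn_add.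
- rewrite disjoint_sym; apply: disjointU1r => //.
  by rewrite disjoint_sym; apply: disjointWr KS disQS.
- move=> x y /setU1P[-> //|xQ] yK xy.
  have xz := QS x y xQ (subsetP KS _ yK) xy.
  by move: (nonnbrs_edge (subsetP KN _ yK)); rewrite -xz xy.
- move=> l' l'A; have [c cK' lc] := leaf_other l' AK.
  exact: (leaf_edge cK KD (subsetP AK _ l'A) l'A cK' lc).
Qed.

Lemma conn_card1 X l : 1 < #|X :&: A| -> exists2 c, c \in X & l != c.
Proof.
move=> gt1; have : 0 < #|(X :&: A) :\ l|.
  by move: gt1; rewrite (cardsD1 l (X :&: A)); case: (l \in _) => //= /ltnW.
by case/card_gt0P=> c /setD1P[cl /setIP[cX _]]; exists c; rewrite 1?eq_sym.
Qed.

Lemma card_pairwise_component X (f : G -> {set G}) (s : seq G) h :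
  uniq (h :: s) -> {subset h :: s <= X} -> h \in f h -> all (fun l => l \in f h) s ->
  size (h :: s) <= #|f h :&: X|.
Proof.
move=> uq sX hf /allP sf; rewrite -(card_uniqP uq) -cardsE; apply: subset_leq_card.
apply/subsetP=> l; rewrite inE => ls; rewrite inE sX // andbT.
by move: ls; rewrite inE => /predU1P[->//|/sf].
Qed.

(** [ramsey1] is applied to all leaves, [ramsey2] to those of one component. The bound [3 < n1]
    provides three later components for the first attachment, or three earlier ones for the last; in
    the second round two components suffice, as a third leg is already fixed. *)
Variables (n1 n2 : nat).
Hypothesis n2_bounds : [/\ M <= n2, t <= n2 & 1 < n2].
Hypothesis ramsey2 : forall (T : eqType) (c : T -> T -> bool * bool) (s : seq T),
  n1 <= size s -> exists i s',
    [/\ subseq s' s, size s' = n2 & pairwise (fun u v => c u v == i) s'].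
Hypothesis n1_bounds : [/\ M <= n1, t <= n1 & 3 < n1].
Hypothesis ramsey1 : forall (T : eqType) (c : T -> T -> bool * bool * (bool * bool)) (s : seq T),
  #|A| <= size s -> exists i s',
    [/\ subseq s' s, size s' = n1 & pairwise (fun u v => c u v == i) s'].

(** At the first split some component [K h] keeps many leaves while a leaf [l'] lies elsewhere. [Q]
    joined to [K l'] through an attachment [t2] serves as [U]; it remains to find a connected part
    of [K h] with many leaves and no neighbor of [t2]. *)
Lemma too_many_links : False.
Proof.
have [Q [z [S [fr noA]]]] := frontier_split.
have [[QD cQ bQ zQ] [SD cS AS] disQS QS zA] := fr.
have zS : z \notin S by rewrite (disjointFr disQS zQ).
have zD := subsetP QD _ zQ.
pose K l := component (nonnbrs S z) l.
have AN l : l \in A -> l \in nonnbrs S z by move=> lA; rewrite inE (subsetP AS) // zA.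
have KN l : l \in A -> K l \subset nonnbrs S z by move=> lA; apply: component_sub (AN _ lA).
have KS l : l \in A -> K l \subset S by move=> lA; apply: subset_trans (KN _ lA) (nonnbrs_sub _ _).
have KD l : l \in A -> K l \subset D by move=> lA; apply: subset_trans (KS _ lA) SD.
have cK l : l \in A -> conn (K l) by move=> lA; apply: conn_component (AN _ lA).
have lK l : l \in K l := component_refl _ _.
have legK l : l \in A -> leg (K l).
  by move=> lA; apply/legP; split; [apply: KD | apply: cK | exists l].
have szK l : l \in A -> sep [set z] (K l).
  move=> lA; rewrite sep1; apply/andP; split; first by apply: contra zS; apply: (subsetP (KS l lA)).
  by apply/nbrP=> -[x /(subsetP (KN l lA))/nonnbrs_edge/negP].
have sepK l l' : l \in A -> l' \in A -> l' \notin K l -> sep (K l) (K l').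
  by move=> lA l'A; apply: component_sep; apply: AN.
have tauE l : exists x, l \in A -> [/\ x \in S, edge z x & nbr x (K l)].
  have [lA|] := boolP (l \in A); last by exists b.
  by have [x [h1 h2 _ h3]] := nonnbrs_exit cS zS (AN l lA); exists x.
have [tau tauP] := fin_all_exists tauE.
have tauK l x : l \in A -> edge z x -> x \notin K l.
  by move=> lA zx; apply/negP=> /(subsetP (KN l lA))/nonnbrs_edge; rewrite zx.
have neq_edge x y : edge x y -> x != y by apply: contraTneq => ->; rewrite edge_irrefl.
have [n1M n1t n1_gt3] := n1_bounds; have [n2M n2t n2_gt1] := n2_bounds.
have [h hA leh] : exists2 h, h \in A & n1 <= #|K h :&: A|.
  pose c l l' := ((l' \in K l, edge (tau l) (tau l')), (nbr (tau l) (K l'), nbr (tau l') (K l))).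
  have [i [s [sub_s size_s pw_s]]] := ramsey1 c (s := enum A) ltac:(by rewrite -cardE).
  have sA : {subset s <= A} by move=> l /(mem_subseq sub_s); rewrite mem_enum.
  have uq_s : uniq s := subseq_uniq sub_s (enum_uniq _).
  case: i pw_s => -[i1 i2] [i3 i4] pw_s.
  have pw1 : pairwise (fun l l' => (l' \in K l) == i1) s.
    by apply: sub_pairwise pw_s => l l' /eqP [<- _ _ _].
  have pw2 : pairwise (fun l l' => edge (tau l) (tau l') == i2) s.
    by apply: sub_pairwise pw_s => l l' /eqP [_ <- _ _].
  have pw3 : pairwise (fun l l' => nbr (tau l) (K l') == i3) s.
    by apply: sub_pairwise pw_s => l l' /eqP [_ _ <- _].
  have pw4 : pairwise (fun l l' => nbr (tau l') (K l) == i4) s.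
    by apply: sub_pairwise pw_s => l l' /eqP [_ _ _ <-].
  case: i1 pw1 {pw_s} => pw1.
    case: s sA uq_s pw1 size_s {sub_s pw2 pw3 pw4} => [|h s] sA uq_s pw1 size_s.
      by rewrite -size_s in n1_gt3.
    exists h; first by apply: sA; apply: mem_head.
    rewrite -size_s; apply: card_pairwise_component => //.
    by case/andP: pw1 => /allP pw1 _; apply/allP=> l /pw1/eqP.
  exfalso; case: i2 pw2 => pw2.
    apply: (no_clique_seq no_clique (s := map tau s)); first by rewrite size_map size_s.
    by rewrite pairwise_map; apply: sub_pairwise pw2 => l l' /eqP.
  case: s size_s sA pw1 pw2 pw3 pw4 {sub_s uq_s} => [|l1 [|l2 [|l3 [|l4 s]]]] size_s sA pw1 pw2 pw3 pw4;
    try by rewrite -size_s in n1_gt3.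
  have [l1A l2A l3A l4A] : [/\ l1 \in A, l2 \in A, l3 \in A & l4 \in A].
    by split; apply: sA; rewrite !inE eqxx ?orbT.
  have [[/eqP k12 /eqP k13 /eqP k14 /eqP k23 /eqP k24] /eqP k34] := pairwise4 pw1.
  have [[/eqP e12 /eqP e13 _ /eqP e23 _] _] := pairwise4 pw2.
  have {}k12 : l2 \notin K l1 by rewrite k12. have {}k13 : l3 \notin K l1 by rewrite k13.
  have {}k14 : l4 \notin K l1 by rewrite k14. have {}k23 : l3 \notin K l2 by rewrite k23.
  have {}k24 : l4 \notin K l2 by rewrite k24. have {}k34 : l4 \notin K l3 by rewrite k34.
  have tauS l : l \in A -> tau l \in D by move=> lA; have [/(subsetP SD)] := tauP l lA.
  have ztau l : l \in A -> edge z (tau l) by move=> lA; have [] := tauP l lA.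
  (* Either the first attachment sees three later components, or the last one sees three earlier
     ones, or each sees only its own among these components and the center of the theta is [z]. *)
  case: i3 pw3 => pw3.
    have [[/eqP m12 /eqP m13 /eqP m14 _ _] _] := pairwise4 pw3.
    by apply: (@no_claw3 (tau l1) (K l2) (K l3) (K l4)); rewrite ?tauS ?legK ?sepK // tauK ?ztau.
  case: i4 pw4 => pw4.
    have [[_ _ /eqP m14 _ /eqP m24] /eqP m34] := pairwise4 pw4.
    by apply: (@no_claw3 (tau l4) (K l1) (K l2) (K l3)); rewrite ?tauS ?legK ?sepK // tauK ?ztau.
  have [[/eqP m12 /eqP m13 _ /eqP m23 _] _] := pairwise4 pw3.
  have [[/eqP n12 /eqP n13 _ /eqP n23 _] _] := pairwise4 pw4.
  have legt l : l \in A -> leg (tau l |: K l).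
    move=> lA; have [_ _ nl] := tauP l lA; apply/legP; split.
    - by rewrite subUset sub1set tauS // KD.
    - by apply: conn_add => //; apply: cK.
    - by exists l; rewrite // in_setU1 lK orbT.
  have zt l : l \in A -> z \notin tau l |: K l.
    move=> lA; rewrite in_setU1 negb_or neq_edge ?ztau //.
    by apply: sep_notin (szK l lA) (set11 _).
  have nzt l : l \in A -> nbr z (tau l |: K l).
    by move=> lA; apply: nbr_intro (setU11 _ _) _; apply: ztau.
  have sept l l' : l \in A -> l' \in A -> l' \notin K l -> edge (tau l) (tau l') = false ->
      nbr (tau l) (K l') = false -> nbr (tau l') (K l) = false ->
      sep (tau l |: K l) (tau l' |: K l').
    move=> lA l'A kll ell nll nll'; rewrite sepUl !sepUr sepK // sep11 ell.
    rewrite (sepC (K l)) !sep1 nll nll' !tauK ?ztau //= !andbT.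
    by apply: contraFneq nll => ->; have [] := tauP l' l'A.
  by apply: (@no_claw3 z _ _ _ zD (legt _ l1A) (legt _ l2A) (legt _ l3A)); rewrite ?zt ?nzt ?sept.
have hN := AN h hA.
have [l' l'A l'K] : exists2 l', l' \in A & l' \notin K h by apply/subsetPn; apply: noA.
have [t2S zt2 nt2] := tauP l' l'A; set t2 := tau l' in t2S zt2 nt2.
have t2D := subsetP SD _ t2S.
have sKK := sepK h l' hA l'A l'K.
have sepQ l : l \in A -> sep Q (K l).
  move=> lA; apply/sepP=> x y xQ yK; have yS := subsetP (KS l lA) _ yK.
  split; first by apply: contraTneq xQ => ->; rewrite (disjointFl disQS yS).
  apply/negP=> xy; have xz := QS x y xQ yS xy.
  by move: (nonnbrs_edge (subsetP (KN l lA) _ yK)); rewrite -xz xy.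
have legt2 : leg (t2 |: K l').
  apply/legP; split; first by rewrite subUset sub1set t2D KD.
    by apply: conn_add => //; apply: cK.
  by exists l'; rewrite // in_setU1 lK orbT.
have [UD ct2 [_ _ _]] := legP _ legt2.
pose U := Q :|: (t2 |: K l').
have legU : leg U.
  apply/legP; split; first by rewrite subUset QD.
    by apply: (connU (x := z) (y := t2)); rewrite ?setU11 ?zt2 ?orbT.
  by exists l'; rewrite // in_setU in_setU1 lK !orbT.
have bU : b \in U by rewrite inE bQ.
have finish (L : {set G}) : L \subset K h -> conn L -> ~~ nbr t2 L -> M <= #|L :&: A| -> False.
  move=> LK cL nL leL; apply: (no_separated_leaves legU bU _ cL _ leL).
    exact: subset_trans LK (KD h hA).
  rewrite sepUl (sepS (subxx _) LK (sepQ h hA)) sepUl sep1 nL andbT /=.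
  rewrite (sepS (subxx _) LK) 1?sepC // andbT.
  by apply: contra (tauK h t2 hA zt2); apply: (subsetP LK).
have [nt2K|nt2K] := boolP (nbr t2 (K h)); last first.
  by apply: (finish (K h)) => //; [apply: cK | apply: leq_trans leh].
have t2Kh : t2 \notin K h by apply: tauK.
have gt1 : 1 < #|K h :&: A| by apply: leq_trans leh; apply: ltnW (ltnW _).
have cK2 : conn (t2 |: K h) by apply: conn_add => //; apply: cK.
(* Since [t2] touches [K h], the argument is repeated inside [K h] with [t2] in the place of [z];
   here [K l'] always provides one leg at [t2]. *)
pose L l := component (nonnbrs (K h) t2) l.
have inN l : l \in K h :&: A -> l \in nonnbrs (K h) t2.
  move=> lKA; case/setIP: (lKA) => lKh lA; rewrite inE lKh.
  have [c cKh lc] := conn_card1 l gt1.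
  exact: (leaf_edge (cK h hA) (KD h hA) lKh lA cKh lc).
have LN l : l \in K h :&: A -> L l \subset nonnbrs (K h) t2 by move=> lA; apply: component_sub (inN _ lA).
have LK l : l \in K h :&: A -> L l \subset K h by move=> lA; apply: subset_trans (LN _ lA) (nonnbrs_sub _ _).
have cL l : l \in K h :&: A -> conn (L l) by move=> lA; apply: conn_component (inN _ lA).
have lL l : l \in L l := component_refl _ _.
have legL l : l \in K h :&: A -> leg (L l).
  move=> lKA; apply/legP; split; [|exact: cL | by exists l => //; case/setIP: lKA].
  exact: subset_trans (LK l lKA) (KD h hA).
have nL l : l \in K h :&: A -> ~~ nbr t2 (L l).
  by move=> lA; apply/nbrP=> -[x /(subsetP (LN l lA))/nonnbrs_edge/negP].
have sepL l m : l \in K h :&: A -> m \in K h :&: A -> m \notin L l -> sep (L l) (L m).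
  by move=> lA mA; apply: component_sep; apply: inN.
have sigE l : exists x, l \in K h :&: A -> [/\ x \in K h, edge t2 x, nbr x (L l) & x \in D].
  have [lA|] := boolP (l \in K h :&: A); last by exists b.
  have [x [h1 h2 _ h3]] := nonnbrs_exit cK2 t2Kh (inN l lA); exists x => _.
  by split=> //; apply: (subsetP (KD h hA)).
have [sig sigP] := fin_all_exists sigE.
pose c l m := (m \in L l, edge (sig l) (sig m)).
have [i [s [sub_s size_s pw_s]]] := ramsey2 c (s := enum (K h :&: A)) ltac:(by rewrite -cardE).
have sA : {subset s <= K h :&: A} by move=> l /(mem_subseq sub_s); rewrite mem_enum.
have uq_s : uniq s := subseq_uniq sub_s (enum_uniq _).
case: i pw_s => i1 i2 pw_s.
have pw1 : pairwise (fun l m => (m \in L l) == i1) s.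
  by apply: sub_pairwise pw_s => l m /eqP [<- _].
have pw2 : pairwise (fun l m => edge (sig l) (sig m) == i2) s.
  by apply: sub_pairwise pw_s => l m /eqP [_ <-].
case: i1 pw1 {pw_s} => pw1.
  case: s sA uq_s pw1 size_s {sub_s pw2} => [|l s] sA uq_s pw1 size_s.
    by rewrite -size_s in n2_gt1.
  have lA : l \in K h :&: A by apply: sA; apply: mem_head.
  apply: (finish (L l)); [exact: LK | exact: cL | exact: nL|].
  apply: leq_trans n2M _; rewrite -size_s; apply: card_pairwise_component => //.
    by move=> m /sA /setIP[].
  by case/andP: pw1 => /allP pw1 _; apply/allP=> m /pw1/eqP.
case: i2 pw2 => pw2.
  apply: (no_clique_seq no_clique (s := map sig s)); first by rewrite size_map size_s.
  by rewrite pairwise_map; apply: sub_pairwise pw2 => l m /eqP.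
case: s size_s sA pw1 pw2 {sub_s uq_s} => [|l [|m s]] size_s sA; try by rewrite -size_s in n2_gt1.
rewrite /= => /andP[/andP[/eqP mL _] _] /andP[/andP[/eqP e12 _] _].
have {}mL : m \notin L l by rewrite mL.
have [lA mA] : l \in K h :&: A /\ m \in K h :&: A by split; apply: sA; rewrite !inE eqxx ?orbT.
have [xK t2x nx xD] := sigP l lA; have [yK t2y ny yD] := sigP m mA.
have notL x k : k \in K h :&: A -> edge t2 x -> x \notin L k.
  by move=> kA t2x'; apply/negP=> /(subsetP (LN k kA))/nonnbrs_edge; rewrite t2x'.
have sepKL k : k \in K h :&: A -> sep (K l') (L k).
  by move=> kA; rewrite sepC; apply: sepS (LK k kA) (subxx _) sKK.
have sept2L k : k \in K h :&: A -> sep (t2 |: K l') (L k).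
  move=> kA; rewrite sepUl sepKL // andbT sep1 nL // andbT.
  by apply: contra t2Kh; apply: (subsetP (LK k kA)).
have shared x : x \in K h -> edge t2 x -> x \in D -> nbr x (L l) -> nbr x (L m) -> False.
  move=> xKh tx xD' nl nm.
  apply: (@no_claw3 x (t2 |: K l') (L l) (L m)); rewrite ?legL ?notL ?sept2L ?sepL //.
  - rewrite in_setU1 negb_or eq_sym neq_edge //=; exact: sep_notin sKK xKh.
  - by apply: nbr_intro (setU11 _ _) _; rewrite edgeC.
have nxm : ~~ nbr (sig l) (L m) by apply/negP=> nm; apply: (shared (sig l)).
have nyl : ~~ nbr (sig m) (L l) by apply/negP=> nl; apply: (shared (sig m)).
have xy : sig l != sig m by apply: contraNneq nxm => ->.
have legs k : k \in K h :&: A -> leg (sig k |: L k).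
  move=> kA; have [_ _ nk kD] := sigP k kA; have [LD cL' _] := legP _ (legL k kA).
  apply/legP; split; [by rewrite subUset sub1set kD | exact: conn_add |].
  by exists k; [rewrite in_setU1 lL orbT | case/setIP: kA].
have seps k : k \in K h :&: A -> sep (K l') (sig k |: L k).
  move=> kA; have [kKh _ _ _] := sigP k kA; rewrite sepUr sepKL // andbT sepC.
  by apply: sepS sKK; rewrite ?sub1set.
have t2s k : k \in K h :&: A -> t2 \notin sig k |: L k.
  move=> kA; have [_ tk _ _] := sigP k kA; rewrite in_setU1 negb_or neq_edge //=.
  by apply: contra t2Kh; apply: (subsetP (LK k kA)).
have nt2s k : k \in K h :&: A -> nbr t2 (sig k |: L k).
  by move=> kA; have [_ tk _ _] := sigP k kA; apply: nbr_intro (setU11 _ _) _.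
apply: (@no_claw3 t2 (K l') (sig l |: L l) (sig m |: L m)); rewrite ?legK ?legs ?seps ?t2s ?nt2s ?tauK //.
rewrite sepUl !sepUr sepL // sep11 xy e12 (sepC (L l)) !sep1 nxm nyl !notL //.
Qed.

End Apex.

(** * Families of internally disjoint paths *)

Section Paths.
Variables (G : sgraph) (a b : G).
Hypothesis neq_ab : a != b.
Hypothesis nedge_ab : ~~ edge a b.
Implicit Types (P Q : seq G).

Lemma induced_path_walk P : induced_path a b P -> exists q,
  [/\ P = [:: a, end_nbr a P & q], path (@edge G) (end_nbr a P) q & last (end_nbr a P) q = b].
Proof.
case: P => [|x [|y q]] [//= [->] lastq uq ind].
  by move: neq_ab; rewrite -lastq eqxx.
have pw : path (@edge G) a (y :: q).
  by apply/(pathP a) => i lt_i; rewrite (ind i i.+1) // ltnS leqnn.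
by exists q; split=> //; case/andP: pw.
Qed.

Lemma end_nbr_edge P : induced_path a b P -> edge a (end_nbr a P).
Proof.
move=> ind; have [nb e_in] := edge_end_nbr neq_ab ind.
by rewrite nb.
Qed.

Lemma end_nbr_interior P : induced_path a b P -> end_nbr a P \in interior a b P.
Proof.
move=> ind; have [_ e_in] := edge_end_nbr neq_ab ind; have ae := end_nbr_edge ind.
rewrite inE e_in /=; apply/andP; split.
  by apply: contraTneq ae => ->; rewrite edge_irrefl.
by apply: contraNneq nedge_ab => <-.
Qed.

Lemma interior_edge P x : induced_path a b P -> x \in interior a b P ->
  edge a x = (x == end_nbr a P).
Proof.
by move=> ind; have [nb _] := edge_end_nbr neq_ab ind; rewrite inE => /andP[/nb].
Qed.

Lemma end_nbr_next P x : induced_path a b P -> x \in interior a b P ->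
  edge (end_nbr a P) x -> x = nth a P 2.
Proof.
move=> ind; rewrite inE => /and3P[xP xa _] ex.
have [q [def_P _ _]] := induced_path_walk ind; case: ind => _ _ _ ind.
have lt_x : index x P < size P by rewrite index_mem.
have nth_x : nth a P (index x P) = x by apply: nth_index.
case def_i: (index x P) => [|[|i]] in lt_x nth_x.
- by case/eqP: xa; rewrite -nth_x def_P.
- by move: ex; rewrite -nth_x edge_irrefl.
- have := ind 1 i.+2; rewrite lt_x => /(_ isT); rewrite nth_x -/(end_nbr a P) ex.
  by move=> /esym/eqP[i0]; rewrite -nth_x i0.
Qed.

End Paths.

Definition later_nbr (G : sgraph) (a b v : G) (Q : seq G) :=
  nbr v (interior a b Q :\ end_nbr a Q).

(** * Families whose first vertices see no other path *)

Section Config.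
Variables (G : sgraph) (a b : G) (s : seq (seq G)).
Hypothesis tpf : theta_prism_free G.
Hypothesis neq_ab : a != b.
Hypothesis nedge_ab : ~~ edge a b.
Hypothesis uq_s : uniq s.
Hypothesis sP : {in s, forall P, induced_path a b P}.
Hypothesis s_disj : {in s &, forall P Q, P != Q -> [disjoint interior a b P & interior a b Q]}.

Lemma end_nbr_inj : {in s &, injective (end_nbr a)}.
Proof.
move=> P Q Ps Qs eq_e; apply/eqP; case: (eqVneq P Q) => // PQ.
have eP := end_nbr_interior neq_ab nedge_ab (sP Ps).
have eQ := end_nbr_interior neq_ab nedge_ab (sP Qs).
by have := disjointFr (s_disj Ps Qs PQ) eP; rewrite eq_e eQ.
Qed.

Lemma interior_inj P Q x : P \in s -> Q \in s -> x \in interior a b P ->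
  x \in interior a b Q -> P = Q.
Proof.
move=> Ps Qs xP xQ; apply/eqP; case: (eqVneq P Q) => // PQ.
by rewrite (disjointFr (s_disj Ps Qs PQ) xP) in xQ.
Qed.

Hypothesis s_b : {in s, forall P, ~~ edge (end_nbr a P) b}.
Hypothesis s_stable : {in s &, forall P Q, P != Q -> ~~ edge (end_nbr a P) (end_nbr a Q)}.
Hypothesis s_later : {in s &, forall P Q, P != Q -> ~~ later_nbr a b (end_nbr a P) Q}.

(** First vertices behave as leaves because the only neighbor of such a vertex in [D] is the third
    vertex of its path, [nth a P 2]: neighbors on other paths and adjacency to [b] are excluded. *)
Lemma no_isolated_starts t n2 n1 M : 1 < t -> 1 < M ->
  ~ (exists K : {set G}, clique K /\ #|K| = t) ->
  (forall (T : eqType) (c : T -> T -> bool) (s : seq T), M <= size s -> exists i s',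
    [/\ subseq s' s, size s' = t.+1 & pairwise (fun u v => c u v == i) s']) ->
  [/\ M <= n2, t <= n2 & 1 < n2] ->
  (forall (T : eqType) (c : T -> T -> bool * bool) (s : seq T), n1 <= size s -> exists i s',
    [/\ subseq s' s, size s' = n2 & pairwise (fun u v => c u v == i) s']) ->
  [/\ M <= n1, t <= n1 & 3 < n1] ->
  (forall (T : eqType) (c : T -> T -> bool * bool * (bool * bool)) (s' : seq T),
    size s <= size s' -> exists i s'',
    [/\ subseq s'' s', size s'' = n1 & pairwise (fun u v => c u v == i) s'']) ->
  1 < size s -> False.
Proof.
move=> t1 M1 no_clique ramM n2P ram2 n1P ram1 s_gt1.
pose D := [set x | (x == b) || has (fun P => x \in interior a b P) s].
pose A := [set x in map (end_nbr a) s].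
have inD P x : P \in s -> x \in interior a b P -> x \in D.
  by move=> Ps xP; rewrite inE; apply/orP; right; apply/hasP; exists P.
have DP x : x \in D -> x = b \/ exists2 P, P \in s & x \in interior a b P.
  by rewrite inE => /predU1P[->|/hasP[P Ps xP]]; [left | right; exists P].
have AP x : x \in A -> exists2 P, P \in s & x = end_nbr a P.
  by rewrite inE => /mapP[P Ps ->]; exists P.
have eA P : P \in s -> end_nbr a P \in A by move=> Ps; rewrite inE map_f.
have eI P : P \in s -> end_nbr a P \in interior a b P.
  by move=> Ps; apply: end_nbr_interior (sP Ps).
have aD : a \notin D.
  apply/negP=> /DP[/eqP|[P _]]; first by rewrite (negPf neq_ab).
  by rewrite inE eqxx andbF.
have bD : b \in D by rewrite inE eqxx.
have bI P : b \notin interior a b P by rewrite inE eqxx !andbF.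
have bA : b \notin A by apply/negP=> /AP[P Ps eb]; have := eI P Ps; rewrite -eb (negPf (bI P)).
have subAD : A \subset D by apply/subsetP=> x /AP[P Ps ->]; apply: inD (eI _ Ps).
have edge_a : {in D, forall v, edge a v = (v \in A)}.
  move=> v /DP[->|[P Ps vP]]; first by rewrite (negPf nedge_ab) (negPf bA).
  rewrite (interior_edge neq_ab (sP Ps) vP); apply/eqP/idP=> [->|/AP[Q Qs vQ]]; first exact: eA.
  by rewrite (interior_inj Ps Qs vP) // vQ eI.
have next P x : P \in s -> x \in D -> edge (end_nbr a P) x -> x = nth a P 2.
  move=> Ps /DP[->|[Q Qs xQ]] ex; first by rewrite (negPf (s_b Ps)) in ex.
  have [PQ|PQ] := eqVneq P Q.
    by subst Q; apply: (end_nbr_next neq_ab (sP Ps) xQ ex).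
  have [xe|xe] := eqVneq x (end_nbr a Q).
    by case/negP: (s_stable Ps Qs PQ); rewrite -xe.
  by case/negP: (s_later Ps Qs PQ); apply: nbr_intro ex; rewrite !inE xe; rewrite inE in xQ.
have leaf1 : {in A & D &, forall l x y, edge l x -> edge l y -> x = y}.
  by move=> _ x y /AP[P Ps ->] xD yD /(next P x Ps xD)-> /(next P y Ps yD)->.
(* [pt l] recovers the path from its first interior vertex [l]. Links do not repeat their starting
   vertex, so [drop 2] removes [a] and [l]. *)
pose pt l := nth [::] s (index l (map (end_nbr a) s)).
pose link l := drop 2 (pt l).
have ptP l : l \in A -> pt l \in s /\ end_nbr a (pt l) = l.
  rewrite inE => ls; have lt_i : index l (map (end_nbr a) s) < size s.
    by rewrite -(size_map (end_nbr a)) index_mem.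
  by split; [apply: mem_nth | rewrite -(nth_map _ a) // nth_index].
have walk l : l \in A -> [/\ path (@edge G) l (link l), last l (link l) = b
    & {in l :: link l, forall x, x = b \/ x \in interior a b (pt l)}].
  move=> lA; have [ps el] := ptP l lA.
  have [q [def_p pq lq]] := induced_path_walk neq_ab (sP ps).
  rewrite el in def_p pq lq; rewrite /link def_p /= drop0; split=> // x x_in.
  have [->|xb] := eqVneq x b; [by left | right].
  have [_ _ uq _] := sP ps; rewrite def_p in uq.
  rewrite inE in_cons x_in orbT xb andbT /=.
  by case/andP: uq => a_notin _; apply: contraNneq a_notin => <-.
have linkP : {in A, forall l, [/\ path (@edge G) l (link l), last l (link l) = b
    & {subset link l <= D}]}.
  move=> l lA; have [h1 h2 h3] := walk l lA; have [ps _] := ptP l lA; split=> // x xl.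
  by have [->//|] := h3 x (@mem_behead _ (l :: link l) x xl); apply: inD.
have link_disj : {in A &, forall l l', l != l' ->
    forall x, x \in l :: link l -> x \in l' :: link l' -> x = b}.
  move=> l l' lA l'A ll' x xl xl'.
  have [_ _ h] := walk l lA; have [_ _ h'] := walk l' l'A.
  have [ps el] := ptP l lA; have [ps' el'] := ptP l' l'A.
  have [//|xp] := h x xl; have [//|xp'] := h' x xl'.
  by case/eqP: ll'; rewrite -el -el' (interior_inj ps ps' xp xp').
have connD : conn D.
  have sub l : l \in A -> {subset l :: link l <= D}.
    move=> lA x xl; have [_ _ h] := walk l lA; have [ps _] := ptP l lA.
    by have [->//|] := h x xl; apply: inD.
  apply: (@conn_root _ _ b) => y /DP[->//|[P Ps yP]].
  have lA := eA P Ps; set l := end_nbr a P in lA.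
  have [pl lastl _] := walk l lA; have [ps el] := ptP l lA.
  have eqP_ : pt l = P by apply: end_nbr_inj.
  have y_in : y \in l :: link l.
    have [q [def_p _ _]] := induced_path_walk neq_ab (sP Ps).
    rewrite /link eqP_ def_p /= drop0; move: yP; rewrite inE {1}def_p => /and3P[].
    by rewrite in_cons => /predU1P[->|//]; rewrite eqxx.
  rewrite (sym_connect_sym (@relin_sym _ D)) -lastl.
  apply: (@connect_trans _ _ l); last exact: walk_connect (sub l lA).
  rewrite (sym_connect_sym (@relin_sym _ D)).
  case/splitPl: y_in pl (sub l lA) => p1 p2 <-; rewrite cat_path => /andP[pl1 _] sub1.
  by apply: walk_connect pl1 _ => x x_in; apply: sub1; rewrite -cat_cons mem_cat x_in.
have b_leaf : {in A, forall l, ~~ edge b l}.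
  by move=> l /AP[P Ps ->]; rewrite edgeC; apply: s_b.
have cardA : #|A| = size s.
  rewrite cardsE; have /card_uniqP-> : uniq (map (end_nbr a) s); last by rewrite size_map.
  by rewrite map_inj_in_uniq //; apply: end_nbr_inj.
rewrite -cardA in ram1 s_gt1.
exact: (too_many_links tpf aD edge_a subAD leaf1 no_clique t1 bD bA linkP
  link_disj M1 ramM connD b_leaf s_gt1 n2P ram2 n1P ram1).
Qed.

End Config.

Lemma pairwise_rev (T : Type) (R : rel T) (s : seq T) :
  pairwise R (rev s) = pairwise (fun x y => R y x) s.
Proof.
elim: s => // x s IH; rewrite rev_cons -cats1 pairwise_cat /= IH allrel1r all_rev andbT.
by [].
Qed.

Theorem theorem7p1 (t nu : nat) (t_ge1 : 1 <= t) (nu_ge1 : 1 <= nu) :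
  exists psi : nat, 1 <= psi /\
  forall G : sgraph,
    theta_prism_free G ->
    ~ (exists K : {set G}, clique K /\ #|K| = t) ->
  forall a b : G, a != b -> ~~ edge a b ->
  forall Ps : seq (seq G),
    uniq Ps ->
    (forall P, P \in Ps -> induced_path a b P) ->
    (forall P Q, P \in Ps -> Q \in Ps -> P != Q ->
       [disjoint interior a b P & interior a b Q]) ->
    psi <= size Ps ->
  exists P : 'I_nu -> seq G,
    [/\ injective P,
        forall i, P i \in Ps,
        stable (b |: [set end_nbr a (P i) | i : 'I_nu])
      & forall i j : 'I_nu, i < j ->
          exists2 x : G, x \in interior a b (P j) :\ end_nbr a (P j)
                       & edge (end_nbr a (P i)) x].
Proof.
(* For [t = 1] any vertex is a forbidden clique, so [psi = 1] works vacuously. *)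
have [t1|le_t1] := ltnP 1 t; last first.
  have t1 : t = 1 by apply/eqP; rewrite eqn_leq le_t1.
  exists 1; split=> // G _ no_clique a; case: no_clique; exists [set a].
  by rewrite cards1 t1; split=> // x y /set1P-> /set1P->; rewrite eqxx.
have [M0 ramM] := ramsey bool t.+1.
(* The constants are chosen backwards: each homogeneous list must be long enough for the next Ramsey
   application and for a clique of size [t]. The 2 gives a set with [M] leaves a vertex besides any
   given leaf, the 4 serves the theta over three further components, and [nu] the conclusion. *)
pose M := maxn M0 2; pose n2 := maxn M t.
have [m1 ram2] := ramsey (bool * bool)%type n2; pose n1 := maxn m1 (maxn M (maxn t 4)).
have [m0 ram1] := ramsey (bool * bool * (bool * bool))%type n1.
pose m := maxn m0 (maxn nu t).
have [N0 ram0] := ramsey (bool * (bool * bool))%type m.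
(* [N3] bounds the number of paths whose first vertex is adjacent to [b]: more would give a clique,
   or three pairwise non-adjacent common neighbors of [a] and [b]. *)
have [N3 ram3] := ramsey bool (maxn t 3).
exists (N0 + N3).+1; split=> // G tpf no_clique a b neq_ab nedge_ab Ps uqPs PsP Ps_disj lePs.
pose e := end_nbr a.
have e_inj : {in Ps &, injective e} by apply: (end_nbr_inj neq_ab nedge_ab PsP) => P Q; apply: Ps_disj.
have sub_uq s : subseq s Ps -> uniq s by move=> /subseq_uniq; apply.
pose good := [seq P <- Ps | ~~ edge (e P) b].
have sub_good : subseq good Ps by apply: filter_subseq.
have le_good : N0 <= size good.
  suff le_bad : size [seq P <- Ps | edge (e P) b] <= N3.
    rewrite -(leq_add2l N3) addnC; apply: leq_trans (ltnW lePs) _.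
    rewrite -(count_predC (fun P => edge (e P) b) Ps) /good !size_filter.
    by rewrite leq_add2r -size_filter.
  rewrite leqNgt; apply/negP=> lt_bad.
  have [i [s [sub_s size_s pw]]] := ram3 _ (fun P Q => edge (e P) (e Q)) _ (ltnW lt_bad).
  have sub_Ps : subseq s Ps := subseq_trans sub_s (filter_subseq _ _).
  case: i pw => pw.
    apply: (no_clique_seq no_clique (s := map e s)); first by rewrite size_map size_s leq_maxl.
    by rewrite pairwise_map; apply: sub_pairwise pw => P Q /eqP.
  apply: (no_K23 tpf neq_ab nedge_ab (s := map e s)).
  - by rewrite size_map size_s leq_maxr.
  - rewrite map_inj_in_uniq ?sub_uq // => P Q Ps_ Qs_; apply: e_inj; exact: (mem_subseq sub_Ps).
  - by rewrite pairwise_map; apply: sub_pairwise pw => P Q /eqP /= ->.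
  - move=> z /mapP[P /(mem_subseq sub_s)]; rewrite mem_filter => /andP[eb PPs] ->.
    by rewrite (end_nbr_edge neq_ab (PsP _ PPs)) edgeC.
(* If the second entry is constantly true, the list is already in the desired order; if the third
   is, its reversal is. *)
pose c P Q := (edge (e P) (e Q), (later_nbr a b (e P) Q, later_nbr a b (e Q) P)).
have [i [s [sub_s size_s pw]]] := ram0 _ c _ le_good.
have sub_Ps : subseq s Ps := subseq_trans sub_s sub_good.
have uq_s := sub_uq s sub_Ps.
have sPs P : P \in s -> P \in Ps by apply: mem_subseq.
have s_b : {in s, forall P, ~~ edge (e P) b}.
  by move=> P /(mem_subseq sub_s); rewrite mem_filter => /andP[].
case: i pw => i1 [i2 i3] pw.
have pw1 : pairwise (fun P Q => edge (e P) (e Q) == i1) s.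
  by apply: sub_pairwise pw => P Q /eqP [<- _ _].
have pw2 : pairwise (fun P Q => later_nbr a b (e P) Q == i2) s.
  by apply: sub_pairwise pw => P Q /eqP [_ <- _].
have pw3 : pairwise (fun P Q => later_nbr a b (e Q) P == i3) s.
  by apply: sub_pairwise pw => P Q /eqP [_ _ <-].
case: i1 pw1 {pw} => pw1.
  exfalso; apply: (no_clique_seq no_clique (s := map e s)).
    by rewrite size_map size_s /m !leq_max leqnn !orbT.
  by rewrite pairwise_map; apply: sub_pairwise pw1 => P Q /eqP.
have s_stable : {in s &, forall P Q, ~~ edge (e P) (e Q)}.
  move=> P Q Ps_ Qs_; have [->|PQ] := eqVneq P Q; first by rewrite edge_irrefl.
  have := pairwise_in pw1 Ps_ Qs_ PQ; rewrite (edgeC (e Q)) orbb; by move=> /eqP->.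
have conclude s' : perm_eq s' s -> pairwise (fun P Q => later_nbr a b (e P) Q) s' ->
  exists P : 'I_nu -> seq G,
    [/\ injective P, forall i, P i \in Ps, stable (b |: [set end_nbr a (P i) | i : 'I_nu])
      & forall i j : 'I_nu, i < j ->
          exists2 x : G, x \in interior a b (P j) :\ end_nbr a (P j)
                       & edge (end_nbr a (P i)) x].
  move=> eq_s pw'; have lt_s (i : 'I_nu) : i < size s'.
    rewrite (perm_size eq_s) size_s; apply: leq_trans (ltn_ord i) _.
    by rewrite /m !leq_max leqnn !orbT.
  pose P (i : 'I_nu) := nth [::] s' i.
  have Ps_ i : P i \in s by rewrite -(perm_mem eq_s) mem_nth.
  exists P; split.
  - move=> i j /eqP; rewrite nth_uniq ?(perm_uniq eq_s) // => /eqP; exact: val_inj.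
  - by move=> i; apply: sPs.
  - move=> x y /setU1P[->|/imsetP[i _ ->]] /setU1P[->|/imsetP[j _ ->]].
    + by rewrite edge_irrefl.
    + by rewrite edgeC; apply: s_b.
    + exact: s_b.
    + exact: s_stable.
  - move=> i j ij; apply/nbrP.
    by have /(pairwiseP [::])/(_ i j) := pw'; apply; rewrite ?inE.
case: i2 pw2 => pw2.
  by apply: (conclude s) => //; apply: sub_pairwise pw2 => P Q /eqP.
case: i3 pw3 => pw3.
  apply: (conclude (rev s)); first by rewrite perm_rev.
  by rewrite pairwise_rev; apply: sub_pairwise pw3 => P Q /eqP.
exfalso; apply: (@no_isolated_starts G a b s tpf neq_ab nedge_ab uq_s _ _ s_b _ _ t n2 n1 M) => //.
- by move=> P /sPs/PsP.
- by move=> P Q /sPs Ps_ /sPs Qs_; apply: Ps_disj.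
- by move=> P Q Ps_ Qs_ _; apply: s_stable.
- move=> P Q Ps_ Qs_ PQ.
  have [pw2' pw3'] : pairwise (fun P Q => ~~ later_nbr a b (e P) Q) s /\
      pairwise (fun P Q => ~~ later_nbr a b (e Q) P) s.
    by split; [apply: sub_pairwise pw2 | apply: sub_pairwise pw3] => ? ? /eqP->.
  have both : pairwise (fun P Q => ~~ later_nbr a b (e P) Q && ~~ later_nbr a b (e Q) P) s.
    by rewrite pairwise_relI pw2'.
  by have /orP[/andP[]|/andP[]] := pairwise_in both Ps_ Qs_ PQ.
- by rewrite leq_max orbT.
- by move=> T c' s' le; apply: ramM; apply: leq_trans le; apply: leq_maxl.
- by split; [apply: leq_maxl | apply: leq_maxr | apply: leq_trans (leq_maxr M0 2) (leq_maxl M t)].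
- by move=> T c' s' le; apply: ram2; apply: leq_trans le; apply: leq_maxl.
- have le4 := leq_maxr M (maxn t 4); have le1 := leq_maxr m1 (maxn M (maxn t 4)).
  split; first exact: leq_trans (leq_maxl _ _) le1.
    exact: leq_trans (leq_maxl _ _) (leq_trans le4 le1).
  exact: leq_trans (leq_maxr _ _) (leq_trans le4 le1).
- move=> T c' s' le; apply: ram1; apply: leq_trans le.
  by rewrite size_s leq_maxl.
- by rewrite size_s !leq_max t1 !orbT.
Qed.
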